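(* For all integers $k\ge0$, $n\ge1$ and $d\ge0$, the continuous cohomology $H^k_c(\mathsf{L}_d(n);\Bbbk)$ is finite-dimensional over $\Bbbk$.
   Context: $\Bbbk$ is a field of characteristic $0$ (e.g. $\mathbb{R}$ or $\mathbb{C}$). $\mathcal{W}_n$ is the Lie algebra of formal vector fields $\sum_{i=1}^n f_i\partial_i$ with $f_i\in\Bbbk[[x_1,\ldots,x_n]]$. For $d\ge0$, $\mathsf{L}_d(n)\subset\mathcal{W}_n$ is the Lie subalgebra of formal vector fields all of whose coefficients $f_i$ contain only monomials of degree $\ge d+1$. $\mathcal{W}_n$ and its subalgebras carry the linear topology in which the subalgebras $\mathsf{L}_m(n)$, $m\ge0$, form a basis of neighbourhoods of $0$. The continuous cohomology $H_c^\bullet(\mathsf{L}_d(n);\Bbbk)$ is the cohomology of the subcomplex $C_c^\bullet$ of the Chevalley–Eilenberg cochain complex (trivial coefficients) formed by continuous skew-symmetric multilinear maps $\mathsf{L}_d(n)\times\cdots\times\mathsf{L}_d(n)\to\Bbbk$ ($\Bbbk$ discrete), i.e. those skew-symmetric multilinear maps for which there is an $m\geq d$ such that the map vanishes whenever one of its arguments lies in $\mathsf{L}_m(n)$. Equivalently, $C_c^\bullet$ is the graded linear dual of the Chevalley–Eilenberg chain complex of the polynomial Lie algebra $\mathsf{L}_d^{\mathrm{pol}}(n)=\mathsf{L}_d(n)\cap\mathcal{W}_n^{\mathrm{pol}}$, where $\mathcal{W}_n^{\mathrm{pol}}$ is the Lie algebra of vector fields with polynomial coefficients. *)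

(* Defs.v *)
From HB Require Import structures.
From mathcomp Require Import all_boot perm all_algebra.
From mathcomp Require Import boolp functions.
From mathcomp Require Import mpoly.

(* Classical logic (boolp) supplies choiceType structures on function types   *)
(* and boolean membership in subspaces; spaces of functions carry their       *)
(* pointwise lmodType structure (functions).                                  *)

Set Implicit Arguments.
Unset Strict Implicit.
Unset Printing Implicit Defensive.

Import GRing.Theory.
Local Open Scope ring_scope.

Section LmodQuotient.
Variables (K : pzRingType) (V : lmodType K) (W : submodClosed V).

Definition submod_mem : {pred V} := fun v => v \in W.

Lemma submod_mem_addr : addr_closed submod_mem.
Proof. by split=> [|u v]; [exact: rpred0 | exact: rpredD]. Qed.

Lemma submod_mem_oppr : oppr_closed submod_mem.
Proof. by move=> u Wu; rewrite -scaleN1r /submod_mem; apply: rpredZ. Qed.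

HB.instance Definition _ :=
  GRing.isAddClosed.Build V submod_mem submod_mem_addr.
HB.instance Definition _ :=
  GRing.isOppClosed.Build V submod_mem submod_mem_oppr.

Definition lmod_quot : Type := Quotient.quot submod_mem.
HB.instance Definition _ := GRing.Zmodule.on lmod_quot.
HB.instance Definition _ :=
  EqQuotient.copy lmod_quot (Quotient.quot submod_mem).

Local Open Scope quotient_scope.

Definition lmod_quot_scale (a : K) (x : lmod_quot) : lmod_quot :=
  \pi_lmod_quot (a *: repr x).

Lemma pi_scale a v :
  lmod_quot_scale a (\pi_lmod_quot v) = \pi_lmod_quot (a *: v).
Proof.
apply/eqP; rewrite /lmod_quot_scale -Quotient.idealrBE -scalerBr.
have : repr (\pi_lmod_quot v) - v \in submod_mem.
  by rewrite Quotient.idealrBE reprK.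
exact: rpredZ.
Qed.

Lemma lmod_quot_scalerA a b x :
  lmod_quot_scale a (lmod_quot_scale b x) = lmod_quot_scale (a * b) x.
Proof.
rewrite -[x]reprK; move: (repr x) => {}x.
by rewrite (pi_scale b x) !pi_scale scalerA.
Qed.

Lemma lmod_quot_scale1r : left_id 1 lmod_quot_scale.
Proof.
by move=> x; rewrite -[x]reprK; move: (repr x) => {}x; rewrite pi_scale scale1r.
Qed.

Let pi_addE u v : \pi_lmod_quot (u + v) = \pi_lmod_quot u + \pi_lmod_quot v.
Proof. exact: (Quotient.pi_add submod_mem). Qed.

Lemma lmod_quot_scalerDr : right_distributive lmod_quot_scale +%R.
Proof.
move=> a x y; rewrite -[x]reprK -[y]reprK.
move: (repr x) (repr y) => {}x {}y.
by rewrite -pi_addE !pi_scale scalerDr pi_addE.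
Qed.

Lemma lmod_quot_scalerDl x : {morph lmod_quot_scale^~ x : a b / a + b}.
Proof.
move=> a b; rewrite -[x]reprK; move: (repr x) => {}x.
by rewrite !pi_scale scalerDl pi_addE.
Qed.

HB.instance Definition _ := GRing.Zmodule_isLmodule.Build K lmod_quot
  lmod_quot_scalerA lmod_quot_scale1r lmod_quot_scalerDr lmod_quot_scalerDl.

End LmodQuotient.

Definition finite_dimensional (K : fieldType) (V : lmodType K) : Prop :=
  exists r : nat, inhabited (Vector.axiom r V).

Section FormalVectorFields.
Variables (K : fieldType) (n : nat).

(* A formal power series is the family of its coefficients: f m is the one of *)
(* the monomial x^m. Its product is fps_mul, not a pointwise product.         *)
Definition fps : Type := 'X_{1..n} -> K.
HB.instance Definition _ := GRing.Lmodule.copy fps ('X_{1..n} -> K^o).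

Definition fps_mul (f g : fps) : fps := fun m =>
  \sum_(p : 'X_{1..n < (mdeg m).+1, (mdeg m).+1} | m == (p.1 + p.2)%MM)
    f p.1 * g p.2.

Definition fps_deriv (j : 'I_n) (f : fps) : fps := fun m =>
  f (m + U_(j))%MM *+ (m j).+1.

(* X i is the coefficient of the i-th partial derivative. *)
Definition vfield : Type := 'I_n -> fps.
HB.instance Definition _ := GRing.Lmodule.copy vfield ('I_n -> fps).

Definition vf_bracket (X Y : vfield) : vfield := fun i =>
  \sum_(j < n) (fps_mul (X j) (fps_deriv j (Y i))
                - fps_mul (Y j) (fps_deriv j (X i))).

(* The formal vector fields whose coefficients only contain monomials of      *)
(* degree at least d + 1.                                                     *)
Definition vf_order (d : nat) : {pred vfield} := fun X =>
  `[< forall i (m : 'X_{1..n}), (mdeg m < d.+1)%N -> X i m = 0 >].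

Lemma vf_order_submod d : submod_closed (vf_order d).
Proof.
split=> [|a X Y]; first by apply/asboolP.
move=> /asboolP X0 /asboolP Y0; apply/asboolP => i m lt_md.
have -> : (a *: X + Y) i m = a * X i m + Y i m by [].
by rewrite X0 // Y0 // mulr0 addr0.
Qed.
HB.instance Definition _ d :=
  GRing.isSubmodClosed.Build K vfield (vf_order d) (vf_order_submod d).

Lemma fps_mul0 d (f g : fps) (m : 'X_{1..n}) : (mdeg m < d.+1)%N ->
  (forall m' : 'X_{1..n}, (mdeg m' < d.+1)%N -> f m' = 0) -> fps_mul f g m = 0.
Proof.
move=> lt_md f0; rewrite /fps_mul big1 // => p /eqP mE.
rewrite f0 ?mul0r // (leq_ltn_trans _ lt_md) //.
by have := leq_addr (mdeg p.2) (mdeg p.1); rewrite -mdegD -mE.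
Qed.

Lemma vf_bracket_order d X Y :
  X \in vf_order d -> Y \in vf_order d -> vf_bracket X Y \in vf_order d.
Proof.
move=> /asboolP X0 /asboolP Y0; apply/asboolP => i m lt_md.
rewrite /vf_bracket fct_sumE big1 // => j _.
have fB (f g : fps) : (f - g) m = f m - g m by [].
by rewrite fB !(fps_mul0 (d := d)) ?subrr //; [exact: Y0 | exact: X0].
Qed.

End FormalVectorFields.

Section LieAlgebraL.
Variables (K : fieldType) (n d : nat).

Record Ld := MkLd { Ld_val :> vfield K n; Ld_valP : Ld_val \in vf_order d }.

HB.instance Definition _ := [isSub for Ld_val].
HB.instance Definition _ := [Choice of Ld by <:].
HB.instance Definition _ := [SubChoice_isSubLmodule of Ld by <:].

Definition Ld_bracket (X Y : Ld) : Ld :=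
  MkLd (vf_bracket_order (Ld_valP X) (Ld_valP Y)).

End LieAlgebraL.

Section ChevalleyEilenberg.
Variables (K : fieldType) (g : lmodType K) (br : g -> g -> g).

Definition cochain k : Type := ('I_k -> g) -> K.
HB.instance Definition _ k :=
  GRing.Lmodule.copy (cochain k) (('I_k -> g) -> K^o).

Definition multilinear k (c : cochain k) : Prop :=
  forall (x : 'I_k -> g) (i : 'I_k) (a : K) (u v : g),
    c [eta x with i |-> a *: u + v]
    = a * c [eta x with i |-> u] + c [eta x with i |-> v].

Definition skew_symmetric k (c : cochain k) : Prop :=
  forall (x : 'I_k -> g) (s : 'S_k), c (x \o s) = (-1) ^+ s * c x.

Definition cons_arg k (u : g) (x : 'I_k -> g) : 'I_k.+1 -> g := fun l =>
  if unlift ord0 l is Some p then x p else u.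

(* (dc)(x_0, ..., x_k) is the sum over i < j of                               *)
(*   (-1)^(i+j) c([x_i, x_j], x_0, ..., omit x_i, ..., omit x_j, ..., x_k).   *)
(* The index i is taken in 'I_k, with j omitted: lift j i has the same value  *)
(* as i when i < j, and p |-> lift j (lift i p) enumerates increasingly the   *)
(* indices other than i and j.                                                *)
Definition ce_diff k : cochain k -> cochain k.+1 :=
  match k with
  | 0 => fun _ _ => 0
  | k'.+1 => fun c x =>
      \sum_(j < k'.+2) \sum_(i < k'.+1 | (i < j)%N)
        (-1) ^+ (i + j) *
        c (cons_arg (br (x (lift j i)) (x j))
                    (fun p => x (lift j (lift i p))))
  end.

End ChevalleyEilenberg.

Section ContinuousCohomology.
Variables (K : fieldType) (n d k : nat).

(* Continuity for K discrete: the vf_order m with m >= d form a basis of      *)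
(* neighbourhoods of 0.                                                       *)
Definition continuous_form l (c : cochain (Ld K n d) l) : Prop :=
  exists2 m : nat, (d <= m)%N &
    forall (x : 'I_l -> Ld K n d) (i : 'I_l),
      Ld_val (x i) \in vf_order m -> c x = 0.

Definition continuous_cochain l (c : cochain (Ld K n d) l) : Prop :=
  [/\ multilinear c, skew_symmetric c & continuous_form c].

Definition Ld_diff l (c : cochain (Ld K n d) l) : cochain (Ld K n d) l.+1 :=
  ce_diff (@Ld_bracket K n d) c.

Definition is_cocycle : {pred cochain (Ld K n d) k} := fun c =>
  `[< continuous_cochain c /\ Ld_diff c = 0 >].

End ContinuousCohomology.

Section Closure.
Variables (K : fieldType) (n d : nat).

Lemma continuous_cochain0 l : @continuous_cochain K n d l 0.
Proof.
split=> [x i a u v|x s|]; [by rewrite mulr0 addr0|by rewrite mulr0|].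
by exists d.
Qed.

Lemma continuous_cochainZD l (a : K) (b c : cochain (Ld K n d) l) :
  continuous_cochain b -> continuous_cochain c ->
  continuous_cochain (a *: b + c).
Proof.
have E x : (a *: b + c) x = a * b x + c x by [].
move=> [lb sb [mb lemb b0]] [lc sc [mc lemc c0]]; split.
- move=> x i e u v; rewrite !E lb lc !mulrDr !mulrA [a * e]mulrC.
  by rewrite !addrA; congr (_ + _); rewrite -!addrA; congr (_ + _); exact: addrC.
- by move=> x s; rewrite !E sb sc mulrDr !mulrA [a * _]mulrC.
- exists (maxn mb mc) => [|x i /asboolP xi0]; first by rewrite leq_max lemb.
  rewrite E (b0 x i) ?(c0 x i) ?mulr0 ?addr0 //;
    apply/asboolP => j m lt_m; apply: xi0;
    by rewrite (leq_trans lt_m) // ltnS (leq_maxl, leq_maxr).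
Qed.

Lemma Ld_diffZD l (a : K) (b c : cochain (Ld K n d) l) :
  Ld_diff (a *: b + c) = a *: Ld_diff b + Ld_diff c.
Proof.
case: l b c => [|l] b c; apply/funext => x.
  have -> : (a *: Ld_diff b + Ld_diff c) x = a * 0 + 0 by [].
  by rewrite mulr0 addr0.
have -> : (a *: Ld_diff b + Ld_diff c) x = a * Ld_diff b x + Ld_diff c x by [].
rewrite /Ld_diff /ce_diff mulr_sumr -big_split; apply: eq_bigr => j _ /=.
rewrite mulr_sumr -big_split; apply: eq_bigr => i _ /=.
have E y : (a *: b + c) y = a * b y + c y by [].
by rewrite E mulrDr !mulrA [a * _]mulrC.
Qed.

Lemma Ld_diff0 l : Ld_diff (0 : cochain (Ld K n d) l) = 0.
Proof.
have := Ld_diffZD (-1) (0 : cochain (Ld K n d) l) 0.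
by rewrite scaler0 addr0 scaleN1r addNr.
Qed.

Lemma cocycle_submod k : submod_closed (@is_cocycle K n d k).
Proof.
split=> [|a b c]; first by apply/asboolP; split;
  [exact: continuous_cochain0 | exact: Ld_diff0].
move=> /asboolP[cb db] /asboolP[cc dc]; apply/asboolP; split.
  exact: continuous_cochainZD.
by rewrite Ld_diffZD db dc scaler0 addr0.
Qed.

HB.instance Definition _ k :=
  GRing.isSubmodClosed.Build K _ (@is_cocycle K n d k) (@cocycle_submod k).

End Closure.

Section Cohomology.
Variables (K : fieldType) (n d k : nat).

Record cocycle := MkCocycle {
  cocycle_val :> cochain (Ld K n d) k;
  cocycle_valP : cocycle_val \in @is_cocycle K n d k }.

HB.instance Definition _ := [isSub for cocycle_val].
HB.instance Definition _ := [Choice of cocycle by <:].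
HB.instance Definition _ := [SubChoice_isSubLmodule of cocycle by <:].

(* Coboundaries of continuous cochains, as a subspace of the cocycles; there  *)
(* are no cochains of degree -1.                                              *)
Definition is_coboundary : {pred cocycle} := fun c =>
  `[< match k return cochain (Ld K n d) k -> Prop with
      | 0 => fun c0 => c0 = 0
      | k'.+1 => fun c0 => exists2 b : cochain (Ld K n d) k',
          continuous_cochain b & c0 = Ld_diff b
      end (cocycle_val c) >].

Lemma coboundary_submod : submod_closed is_coboundary.
Proof.
rewrite /is_coboundary; split=> [|a b c].
  apply/asboolP; have -> : cocycle_val 0 = 0 by exact: (raddf0 val).
  case: (k) => [//|k']; exists 0; first exact: continuous_cochain0.
  by rewrite Ld_diff0.
have E : cocycle_val (a *: b + c) = a *: cocycle_val b + cocycle_val c.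
  exact: (linearP val).
move=> /asboolP Bb /asboolP Bc; apply/asboolP; rewrite {}E.
move: (cocycle_val b) (cocycle_val c) Bb Bc.
case: (k) => [_ _ -> ->|k' _ _ [b' Cb ->] [c' Cc ->]].
  by rewrite scaler0 addr0.
by exists (a *: b' + c'); [exact: continuous_cochainZD | rewrite Ld_diffZD].
Qed.

HB.instance Definition _ :=
  GRing.isSubmodClosed.Build K cocycle is_coboundary coboundary_submod.

Definition Hc : lmodType K := lmod_quot is_coboundary.

End Cohomology.

(* Main.v *)
Require Import Defs.
From mathcomp Require Import all_boot all_order perm all_algebra all_fingroup.
From mathcomp Require Import boolp functions.
From mathcomp Require Import mpoly.
From mathcomp Require Import zify ring.

(* Write a tuple of monomial fields x^a d/dx_p as b, with weight wt b = sum   *)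
(* (|a| - 1). A continuous cochain is a finitely supported function of such   *)
(* tuples, and it suffices to show that every k-cocycle is cohomologous to    *)
(* one supported in bounded weight.                                           *)
(*   For a direction l, let g_j act on k-tuples as the derivation extending   *)
(* x^a d/dx_p |-> a_l x^a x_l^j d/dx_p. For j >= d this is, up to terms of    *)
(* lower order in the weight, the Lie derivative along e_j = x_l^(j+1) d/dx_l *)
(* in L_d; for every j, g_j commutes with the differential up to lower order. *)
(* To leading order g_j = sum_q a_q s_q^j, where s_q shifts the q-th          *)
(* exponent, so the matrix (g_(m(r - r'))) has rank at most k and its minor   *)
(* of size k + 1 vanishes. Each term of this minor other than the diagonal    *)
(* one, g_0^(k+1), contains some g_j with j >= m > d. Replacing this factor   *)
(* by the contraction with e_j gives an operator h lowering the degree by     *)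
(* one, and by Cartan's formula d h c = (sum_l g_0^(k+1) + E) c for every     *)
(* cocycle c, where g_0 is multiplication by the total l-degree. The row sums *)
(* of E are O(wt^k) and the diagonal term is at least of order wt^(k+1): in   *)
(* large weight d h is an integral diagonally dominant matrix, hence          *)
(* invertible in characteristic 0, and c is a coboundary there.               *)

Set Implicit Arguments.
Unset Strict Implicit.
Unset Printing Implicit Defensive.

Import Order.TTheory GRing.Theory Num.Theory.
Local Open Scope ring_scope.

(** * Linear algebra *)

(** The Euler field, by Cartan's formula, would confine cohomology to weight 0, but for d > 0 it
    does not lie in L_d. The operator [homotopy] replaces contraction with it: on cocycles, d
    [homotopy] is multiplication by [diagonal], of order wt^(k+2) in degree k+1, plus an error of
    order wt^(k+1). The relation behind this is [leading_alternate]. The errors made in using it are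
    those of [word_leading] (shifts do not quite commute), [tuple_diff_word] (words do not quite
    commute with d) and [lie_der_growth] (shifts are not quite Lie derivatives); [defect_growth]
    collects them, and [diagonal_large] shows that the diagonal wins in large weight. Sizes are
    measured on integral coefficients, since K carries no absolute value. To invert d [homotopy],
    [cocycle_small_weight] uses that a continuous cocycle c has bounded weight and that d [homotopy]
    preserves weight: the iterates of c live on finitely many tuples, and by Cayley-Hamilton
    ([diag_dominant_orbit]) c is a combination of its positive iterates, which are exact, in every
    weight above a threshold. The threshold does not depend on c, so cocycles of bounded weight
    represent all of the cohomology. By [coefs_eq0] finitely many values determine them, and
    [finite_dimensional_quot] concludes. *)

Lemma diag_dominant_det n (A : 'M[int]_n) :
  (forall i, \sum_(j | j != i) `|A i j| < `|A i i|) -> \det A != 0.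
Proof.
move=> domA; apply: contra_neqT (oner_neq0 int) => /negPn detA0.
have /det0P[v v0 vA] : \det (map_mx intr A^T : 'M[rat]_n) == 0.
  by rewrite det_map_mx det_tr (eqP detA0).
have [i0 vi0] : exists i, v 0 i != 0.
  apply/existsP; apply: contraT; rewrite negb_exists => /forallP v00.
  by case/eqP: v0; apply/rowP => i; rewrite mxE; apply/eqP; have := v00 i; rewrite negbK.
have [i _ maxi] := @arg_maxP _ _ _ i0 xpredT (fun i => `|v 0 i|) isT.
have {}maxi j : `|v 0 j| <= `|v 0 i| by exact: maxi.
have vi : 0 < `|v 0 i| by rewrite (lt_le_trans _ (maxi i0)) // normr_gt0.
have : (\sum_(j | j != i) `|A i j|)%:~R * `|v 0 i| < `|A i i|%:~R * `|v 0 i|.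
  by rewrite ltr_pM2r // ltr_int.
suff le_i : `|A i i|%:~R * `|v 0 i| <= (\sum_(j | j != i) `|A i j|)%:~R * `|v 0 i|.
  by rewrite ltNge le_i.
have /eqP := congr1 (fun w : 'rV_n => w 0 i) vA.
rewrite !mxE (bigD1 i) //= !mxE addrC addr_eq0 => /eqP sumE.
rewrite intr_norm -normrM mulrC -normrN -sumE (le_trans (ler_norm_sum _ _ _)) //.
rewrite rmorph_sum /= mulr_suml ler_sum // => j ji.
by rewrite !mxE normrM mulrC -intr_norm ler_wpM2l ?ler0z.
Qed.

Lemma char0_intr_neq0 (K : fieldType) (z : int) :
  [pchar K] =i pred0 -> z != 0 -> z%:~R != 0 :> K.
Proof.
move=> /pcharf0P charK0; case: z => m z0.
  by rewrite -[_%:~R]/(m%:R) charK0.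
by rewrite NegzE mulrNz oppr_eq0 -[_%:~R]/(m.+1%:R) charK0.
Qed.

(* The Cayley-Hamilton theorem writes 1 as a combination of the positive      *)
(* powers of an invertible matrix.                                            *)
Lemma diag_dominant_orbit (K : fieldType) (charK0 : [pchar K] =i pred0)
    (I : finType) (A : I -> I -> int) (x : nat -> I -> K) :
  (forall i, \sum_(j | j != i) `|A i j| < `|A i i|) ->
  (forall t i, x t.+1 i = \sum_j (A i j)%:~R * x t j) ->
  exists T, exists q : nat -> K,
    forall i, x 0%N i = \sum_(t < T) q t * x t.+1 i.
Proof.
move=> domA xS.
case cardI : #|I| => [|n].
  by exists 0%N, (fun=> 0) => i; have := card0_eq cardI i; rewrite inE.
pose e (j : 'I_n.+1) : I := enum_val (cast_ord (esym cardI) j).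
pose r (i : I) : 'I_n.+1 := cast_ord cardI (enum_rank i).
have re : cancel r e by move=> i; rewrite /r /e cast_ordK enum_rankK.
have er : cancel e r by move=> j; rewrite /r /e enum_valK cast_ordKV.
have sumI (V : zmodType) (P : pred I) (F : I -> V) : \sum_(i | P i) F i = \sum_(j | P (e j)) F (e j).
  by apply: reindex; exists r => j _; rewrite ?re ?er.
pose B : 'M[int]_n.+1 := \matrix_(i, j) A (e i) (e j).
have detB : \det B != 0.
  apply: diag_dominant_det => i; rewrite mxE.
  apply: le_lt_trans (domA (e i)); rewrite sumI.
  rewrite (eq_bigl (fun j => e j != e i)) => [|j]; last by rewrite (can_eq er).
  by apply: ler_sum => j _; rewrite mxE.
pose M : 'M[K]_n.+1 := map_mx intr B.
have detM : \det M != 0 by rewrite det_map_mx char0_intr_neq0.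
pose X t : 'cV[K]_n.+1 := \col_j x t (e j).
have XS t : X t.+1 = M *m X t.
  apply/colP => i; rewrite !mxE xS sumI; apply: eq_bigr => j _.
  by rewrite !mxE.
have XE t : X t = M ^+ t *m X 0%N.
  elim: t => [|t IHt]; first by rewrite expr0 mul1mx.
  by rewrite XS IHt exprS mulmxA.
have hornerX (p : {poly K}) :
    horner_mx M p *m X 0%N = \sum_(t < size p) p`_t *: X t.
  rewrite -{1}[p]coefK poly_def rmorph_sum mulmx_suml; apply: eq_bigr => t _.
  rewrite -mul_polyC rmorphM rmorphXn /= horner_mx_X horner_mx_C.
  by rewrite -mulmxE mul_scalar_mx -scalemxAl -XE.
have := hornerX (char_poly M); rewrite Cayley_Hamilton mul0mx => /esym CH.
have c0 : (char_poly M)`_0 != 0.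
  by rewrite char_poly_det mulf_neq0 // expf_neq0 // oppr_eq0 oner_eq0.
move: CH; rewrite size_char_poly big_ord_recl /= => /eqP.
rewrite addr_eq0 => /eqP X0.
exists n.+1, (fun t => - ((char_poly M)`_0)^-1 * (char_poly M)`_t.+1) => i.
have /(congr1 (fun Y : 'cV_n.+1 => Y (r i) 0)) := X0.
rewrite !mxE re => /(canRL (mulKf c0)) ->.
rewrite summxE mulrN mulr_sumr -sumrN; apply: eq_bigr => t _.
by rewrite !mxE re !mulNr mulrA.
Qed.

Definition lin_dependent (K : fieldType) (V : lmodType K) r (v : 'I_r -> V) :=
  exists2 a : 'rV[K]_r, a != 0 & \sum_i a 0 i *: v i = 0.

(** An independent family of maximal length exists, and by maximality it spans; its coordinates give
    the isomorphism with row vectors. *)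
Lemma finite_dimensional_dependent (K : fieldType) (V : lmodType K) N :
  (forall v : 'I_N.+1 -> V, lin_dependent v) -> finite_dimensional V.
Proof.
move=> depV.
pose indep r := `[< exists v : 'I_r -> V, ~ lin_dependent v >].
have ex0 : exists r, indep r.
  exists 0%N; apply/asboolP; exists (fun=> 0) => -[a /eqP[]].
  by apply/rowP => -[].
have ubN r : indep r -> (r <= N)%N.
  move=> /asboolP[v ndep]; rewrite leqNgt; apply/negP => ltNr; apply: ndep.
  have [a a0 sum0] := depV (fun i => v (widen_ord ltNr i)).
  exists (\row_i if insub (i : nat) is Some j then a 0 j else 0).
    apply: contraNneq a0 => a0; apply/eqP/rowP => i.
    have /rowP/(_ (widen_ord ltNr i)) := a0.
    rewrite !mxE; case: insubP => [j _ ji|]; last by rewrite /= ltn_ord.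
    by move=> <-; congr (a 0 _); apply: val_inj; rewrite ji.
  rewrite -{}[RHS]sum0 (bigID (fun i : 'I_r => (i < N.+1)%N)) /=.
  rewrite [X in _ + X]big1 ?addr0; last first.
    by move=> i iN; rewrite mxE insubF ?scale0r //; apply: negbTE.
  rewrite (big_ord_narrow ltNr); apply: eq_bigr => i _.
  by rewrite mxE valK.
have [r /asboolP[v ndep] maxr] := ex_maxnP ex0 ubN.
have spanv w : {a : 'rV[K]_r | w = \sum_i a 0 i *: v i}.
  apply: cid; pose v' i := if unlift ord0 i is Some j then v j else w.
  have [a a0 sum0] : lin_dependent v'.
    have [//|ndep'] := pselect (lin_dependent v').
    by have := maxr r.+1; rewrite ltnn => H; suff: false by []; apply: H; apply/asboolP; exists v'.
  move: sum0; rewrite big_ord_recl {1}/v' unlift_none.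
  under eq_bigr do rewrite /v' liftK.
  move=> /eqP; rewrite addr_eq0 => /eqP sumE.
  have a00 : a 0 ord0 != 0.
    apply: contraPneq ndep => a00; apply.
    exists (\row_i a 0 (lift ord0 i)).
      apply: contraNneq a0 => a'0; apply/eqP/rowP => i; rewrite mxE.
      case: (unliftP ord0 i) => [j|] -> //.
      by have /rowP/(_ j) := a'0; rewrite !mxE.
    under eq_bigr do rewrite mxE.
    by apply/eqP; rewrite -oppr_eq0 -sumE a00 scale0r.
  exists (\row_i (- (a 0 ord0)^-1 * a 0 (lift ord0 i))).
  rewrite -[LHS]scale1r -(mulVf a00) -scalerA sumE scalerN -scaleNr scaler_sumr.
  by apply: eq_bigr => i _; rewrite mxE scalerA.
have uniqv (a b : 'rV[K]_r) : \sum_i a 0 i *: v i = \sum_i b 0 i *: v i -> a = b.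
  move=> /eqP; rewrite -subr_eq0 -sumrB => /eqP ab.
  apply/eqP; rewrite -subr_eq0; apply/negPn/negP => ab0; apply: ndep.
  by exists (a - b) => //; rewrite -{}[RHS]ab; apply: eq_bigr => i _; rewrite !mxE scalerBl.
exists r; constructor.
exists (fun w => sval (spanv w)) => [a w1 w2|].
  apply: uniqv; rewrite -(svalP (spanv _)) [in LHS](svalP (spanv w1)) [in LHS](svalP (spanv w2)).
  rewrite scaler_sumr -big_split; apply: eq_bigr => i _ /=.
  by rewrite !mxE scalerDl scalerA.
exists (fun a : 'rV_r => \sum_i a 0 i *: v i) => [w|a].
  by rewrite -(svalP (spanv w)).
by apply: uniqv; rewrite -(svalP (spanv _)).
Qed.

Lemma lin_dependent_row (K : fieldType) N (w : 'I_N.+1 -> 'rV[K]_N) : lin_dependent w.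
Proof.
pose A := \matrix_i w i.
have /rowV0Pn[a /sub_kermxP aA a0] : kermx A != 0.
  rewrite kermx_eq0 /row_free; apply/eqP => rA.
  by have := rank_leq_col A; rewrite rA ltnn.
exists a => //; rewrite -{}[RHS]aA mulmx_sum_row; apply: eq_bigr => i _.
by rewrite rowK.
Qed.

(** [S] is a subspace that still maps onto the quotient and embeds in K^N through [ev]. Any N + 1
    vectors of the quotient lift to [S], where a relation between their images in K^N is a relation
    between the lifts. *)
Lemma finite_dimensional_quot (K : fieldType) (Z V : lmodType K) (p : Z -> V)
    (S : Z -> Prop) N (ev : 'I_N -> Z -> K) :
  linear p -> (forall v, exists2 z, S z & p z = v) ->
  (forall a y z, S y -> S z -> S (a *: y + z)) -> S 0 ->
  (forall i, scalar (ev i)) -> (forall z, S z -> (forall i, ev i z = 0) -> z = 0) ->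
  finite_dimensional V.
Proof.
move=> lin_p surj SD S0 lin_ev inj.
apply: (@finite_dimensional_dependent _ _ N) => v.
have [z Sz] : exists2 z : 'I_N.+1 -> Z, (forall i, S (z i)) & forall i, p (z i) = v i.
  pose zv i := cid2 (surj (v i)).
  by exists (fun i => s2val (zv i)) => i; [exact: (s2valP (zv i)) | exact: (s2valP' (zv i))].
move=> pz; have [a a0 sum0] := lin_dependent_row (fun i => \row_j ev j (z i)).
exists a => //.
have sumP r (b : 'I_r -> K) (y : 'I_r -> Z) : (forall i, S (y i)) ->
  [/\ S (\sum_i b i *: y i), p (\sum_i b i *: y i) = \sum_i b i *: p (y i) &
      forall j, ev j (\sum_i b i *: y i) = \sum_i b i * ev j (y i)].
  have p0 : p 0 = 0.
    by have := lin_p (-1) 0 0; rewrite scaler0 addr0 scaleN1r addNr.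
  have e0 j : ev j 0 = 0.
    by have := lin_ev j (-1) 0 0; rewrite scaler0 addr0 mulN1r addNr.
  elim: r b y => [|r IHr] b y Sy; first by rewrite !big_ord0; split=> // j; rewrite !big_ord0 e0.
  have [IH1 IH2 IH3] := IHr (b \o lift ord0) (y \o lift ord0) (fun i => Sy (lift ord0 i)).
  rewrite !big_ord_recl; split; first by apply: SD.
    by rewrite lin_p IH2.
  by move=> j; rewrite big_ord_recl lin_ev IH3.
have [S1 p1 e1] := sumP _ (fun i => a 0 i) z Sz.
have -> : \sum_i a 0 i *: v i = p (\sum_i a 0 i *: z i).
  by rewrite p1; apply: eq_bigr => i _; rewrite pz.
rewrite (inj _ S1) => [|j].
  by have := lin_p (-1) 0 0; rewrite scaler0 addr0 scaleN1r addNr.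
move/rowP/(_ j): sum0; rewrite mxE summxE => sum0; rewrite e1 -[RHS]sum0.
by apply: eq_bigr => i _; rewrite !mxE.
Qed.

(** * Brackets of monomial vector fields *)

Section PolynomialVectorFields.
Variables (K : fieldType) (n : nat).
Implicit Types (f : {mpoly K[n]}) (P Q R : 'I_n -> {mpoly K[n]}).

Definition vf_of_poly P : vfield K n := fun i m => (P i)@_m.

Definition poly_bracket P Q : 'I_n -> {mpoly K[n]} := fun i =>
  \sum_j (P j * (Q i)^`M(j) - Q j * (P i)^`M(j)).

Lemma vf_bracket_of_poly P Q :
  vf_bracket (vf_of_poly P) (vf_of_poly Q) = vf_of_poly (poly_bracket P Q).
Proof.
apply/funext => i; apply/funext => m.
rewrite /vf_bracket /vf_of_poly /poly_bracket fct_sumE raddf_sum.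
apply: eq_bigr => j _.
have mulE f g : fps_mul (fun m => f@_m) (fun m => g@_m) m = (f * g)@_m.
  by rewrite mcoeffM.
have derivE f : fps_deriv j (fun m => f@_m) = fun m => (f^`M(j))@_m.
  by apply/funext => m'; rewrite mcoeff_deriv.
by rewrite raddfB /= -!mulE !derivE.
Qed.

Definition vf_deriv P f := \sum_j P j * f^`M(j).

Lemma poly_bracketE P Q i : poly_bracket P Q i = vf_deriv P (Q i) - vf_deriv Q (P i).
Proof. exact: sumrB. Qed.

Lemma vf_derivB P f g : vf_deriv P (f - g) = vf_deriv P f - vf_deriv P g.
Proof. by rewrite -sumrB; apply: eq_bigr => j _; rewrite mderivB mulrBr. Qed.

(** The second-order terms of the two compositions agree because partial derivatives commute. The
    Jacobi identity is then a formal consequence. *)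
Lemma vf_deriv_bracket P Q f :
  vf_deriv (poly_bracket P Q) f = vf_deriv P (vf_deriv Q f) - vf_deriv Q (vf_deriv P f).
Proof.
have D2 P' Q' : vf_deriv P' (vf_deriv Q' f) =
    (\sum_j vf_deriv P' (Q' j) * f^`M(j)) +
    \sum_i \sum_j P' i * Q' j * f^`M(j)^`M(i).
  rewrite /vf_deriv; under eq_bigr => i _.
    rewrite linear_sum mulr_sumr /=.
    under eq_bigr do rewrite mderivM mulrDr !mulrA.
    rewrite big_split /=; over.
  rewrite big_split /= exchange_big /=; congr (_ + _).
  by apply: eq_bigr => j _; rewrite mulr_suml.
rewrite !D2 [X in _ = _ + X - _]exchange_big /=.
have -> : \sum_j \sum_i P i * Q j * f^`M(j)^`M(i) =
          \sum_j \sum_i Q j * P i * f^`M(i)^`M(j).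
  by apply: eq_bigr => j _; apply: eq_bigr => i _; rewrite mderiv_comm (mulrC (P i)).
rewrite opprD addrACA subrr addr0 -sumrB; apply: eq_bigr => j _.
by rewrite poly_bracketE mulrBl.
Qed.

Lemma poly_bracket_jacobi P Q R i :
  poly_bracket (poly_bracket P Q) R i + poly_bracket (poly_bracket Q R) P i +
  poly_bracket (poly_bracket R P) Q i = 0.
Proof.
by rewrite !poly_bracketE !vf_deriv_bracket !vf_derivB; ring.
Qed.

End PolynomialVectorFields.

Section Monomials.
Variables (K : fieldType) (n d : nat).
Implicit Types (a b : 'X_{1..n} * 'I_n) (x y z : Ld K n d).

Fact Ld_proj_subproof (X : vfield K n) :
  (fun i m => if (mdeg m < d.+1)%N then 0 else X i m) \in vf_order (K := K) (n := n) d.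
Proof. by apply/asboolP => i m ->. Qed.

Definition Ld_proj (X : vfield K n) : Ld K n d := MkLd (Ld_proj_subproof X).

(* The vector field x^a.1 d/dx_a.2, replaced by 0 when it is not in Ld. *)
Definition xmono a : Ld K n d :=
  Ld_proj (fun i m => ((i == a.2) && (m == a.1))%:R).

Definition valid a := (d < mdeg a.1)%N.

Lemma xmono_invalid a : ~~ valid a -> xmono a = 0.
Proof.
rewrite /valid -leqNgt -ltnS => da; apply: val_inj; apply/funext => i; apply/funext => m /=.
by case: ifP => //; case: (m =P a.1) => [->|_ _]; rewrite ?andbF // ltnS -ltnS da.
Qed.

Lemma xmonoE a i m : valid a ->
  Ld_val (xmono a) i m = ((i == a.2) && (m == a.1))%:R.
Proof.
move=> va /=; case: ifP => //; case: (m =P a.1) => [->|_]; last by rewrite andbF.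
by rewrite ltnS leqNgt (va : (d < _)%N).
Qed.

Lemma xmono_poly a : valid a ->
  Ld_val (xmono a) = vf_of_poly (fun i => (i == a.2)%:R *: 'X_[a.1]).
Proof.
move=> va; apply/funext => i; apply/funext => m.
by rewrite xmonoE // /vf_of_poly mcoeffZ mcoeffX [a.1 == m]eq_sym -natrM mulnb.
Qed.

Lemma Ld_val_bracket x y : Ld_val (Ld_bracket x y) = vf_bracket (Ld_val x) (Ld_val y).
Proof. by []. Qed.

Lemma mdeg_subU (m : 'X_{1..n}) j : m j != 0%N -> mdeg (m - U_(j)) = (mdeg m).-1.
Proof. by rewrite -lep1mP => /submK {2}<-; rewrite mdegD mdeg1 addn1. Qed.

(** Where the subtraction of exponents truncates, the coefficient in front is 0. *)
Lemma Ld_bracket_mono a b : valid a -> valid b ->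
  Ld_bracket (xmono a) (xmono b) =
  (b.1 a.2)%:R *: xmono ((a.1 + b.1 - U_(a.2))%MM, b.2)
  - (a.1 b.2)%:R *: xmono ((a.1 + b.1 - U_(b.2))%MM, a.2).
Proof.
have side p q (vp : valid p) (vq : valid q) i m :
    (vf_deriv (fun i => (i == p.2)%:R *: 'X_[p.1]) ((i == q.2)%:R *: 'X_[q.1]) : {mpoly K[n]})@_m
    = (q.1 p.2)%:R * Ld_val (xmono ((p.1 + q.1 - U_(p.2))%MM, q.2)) i m.
  rewrite /vf_deriv (bigD1 p.2) //= big1 ?addr0 => [|j /negPf ->]; last first.
    by rewrite scale0r mul0r.
  rewrite eqxx scale1r mderivZ mderivX -!scalerAr !mcoeffZ -mpolyXD mcoeffX.
  case: (eqVneq (q.1 p.2) 0%N) => [->|qp]; first by rewrite !mul0r mulr0.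
  rewrite addmBA ?lep1mP // mulrCA [_ == m]eq_sym -natrM mulnb; congr (_ * _).
  case: ifP => //; case: (m =P _) => [->|_ _]; last by rewrite andbF.
  move: vp vq; rewrite /valid mdeg_subU ?mdegD ?mnmDE ?addn_eq0 ?(negPf qp) ?andbF //.
  by lia.
move=> va vb; apply: val_inj; apply/funext => i; apply/funext => m.
rewrite [\val (Ld_bracket _ _)]Ld_val_bracket !xmono_poly // vf_bracket_of_poly /vf_of_poly poly_bracketE mcoeffB.
by rewrite !side // [(b.1 + a.1)%MM]addmC.
Qed.

(** Monomials suffice: [coefs_eq0] reduces identities between continuous cochains to them, and for
    them the computation takes place in polynomials. *)
Lemma Ld_jacobi_mono a b c : valid a -> valid b -> valid c ->
  Ld_bracket (Ld_bracket (xmono a) (xmono b)) (xmono c) +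
  Ld_bracket (Ld_bracket (xmono b) (xmono c)) (xmono a) +
  Ld_bracket (Ld_bracket (xmono c) (xmono a)) (xmono b) = 0.
Proof.
move=> va vb vc; apply: val_inj; apply/funext => i; apply/funext => m.
have LE x y z : Ld_val (x + y + z) i m = Ld_val x i m + Ld_val y i m + Ld_val z i m.
  by [].
rewrite [LHS]LE !Ld_val_bracket !xmono_poly // !vf_bracket_of_poly -[RHS]/(0 : K) -(mcoeff0 K m).
by rewrite -(poly_bracket_jacobi (fun i => (i == a.2)%:R *: 'X_[a.1])
  (fun i => (i == b.2)%:R *: 'X_[b.1]) (fun i => (i == c.2)%:R *: 'X_[c.1]) i) !mcoeffD.
Qed.

End Monomials.

(** * Bilinearity of the bracket and exponent shifts on L_d *)

Section LdOperations.
Variables (K : fieldType) (n d : nat).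
Implicit Types (x y z : Ld K n d) (f g h : fps K n) (m : 'X_{1..n}).

Lemma Ld_valZD (e : K) x y i m :
  Ld_val (e *: x + y) i m = e * Ld_val x i m + Ld_val y i m.
Proof. by []. Qed.

Lemma fpsBE f g m : (f - g) m = f m - g m.
Proof. by []. Qed.

Lemma LdP x y : (forall i m, Ld_val x i m = Ld_val y i m) -> x = y.
Proof. by move=> E; apply: val_inj; apply/funext => i; apply/funext => m; exact: E. Qed.

Lemma Ld_bracketC x y : Ld_bracket x y = - Ld_bracket y x.
Proof.
apply: LdP => i m; rewrite -[RHS]/(- Ld_val (Ld_bracket y x) i m) !Ld_val_bracket /vf_bracket.
rewrite !fct_sumE -sumrN; apply: eq_bigr => j _.
by rewrite !fpsBE opprB.
Qed.

Lemma fps_mulDl (e : K) f g h m :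
  fps_mul (e *: f + g) h m = e * fps_mul f h m + fps_mul g h m.
Proof.
rewrite mulr_sumr -big_split; apply: eq_bigr => p _ /=.
by rewrite -[(_ + g) _]/(e * f p.1 + g p.1) mulrDl mulrA.
Qed.

Lemma fps_mulDr (e : K) f g h m :
  fps_mul h (e *: f + g) m = e * fps_mul h f m + fps_mul h g m.
Proof.
rewrite mulr_sumr -big_split; apply: eq_bigr => p _ /=.
by rewrite -[(_ + g) _]/(e * f p.2 + g p.2) mulrDr mulrCA.
Qed.

Lemma fps_derivD j (e : K) f g :
  fps_deriv j (e *: f + g) = e *: fps_deriv j f + fps_deriv j g.
Proof.
apply/funext => m; rewrite -[RHS]/(e * fps_deriv j f m + fps_deriv j g m).
by rewrite /fps_deriv -[(_ + g) _]/(e * f _ + g _) mulrnDl mulrnAr.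
Qed.

Lemma Ld_bracketDl (e : K) x y z :
  Ld_bracket (e *: x + y) z = e *: Ld_bracket x z + Ld_bracket y z.
Proof.
apply: LdP => i m; rewrite Ld_valZD !Ld_val_bracket /vf_bracket.
rewrite !fct_sumE mulr_sumr -big_split; apply: eq_bigr => j _ /=.
rewrite !fpsBE.
have E j' : (e *: Ld_val x + Ld_val y) j' = e *: Ld_val x j' + Ld_val y j' by [].
rewrite !E.
by rewrite fps_mulDl fps_derivD fps_mulDr; ring.
Qed.

Lemma fps_mul_order a b f g m :
  (forall m', (mdeg m' < a)%N -> f m' = 0) ->
  (forall m', (mdeg m' < b)%N -> g m' = 0) ->
  (mdeg m < a + b)%N -> fps_mul f g m = 0.
Proof.
move=> f0 g0 lt_m; rewrite /fps_mul big1 // => p /eqP mE.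
have [lt1|le1] := ltnP (mdeg p.1) a; first by rewrite f0 ?mul0r.
rewrite g0 ?mulr0 //; have E := etrans (congr1 (@mdeg n) mE) (mdegD _ _).
by rewrite -(ltn_add2l (mdeg p.1)) -E (leq_trans lt_m) // leq_add2r.
Qed.

(** The fields of order r form an ideal: the derivative loses one degree, and a coefficient of [y]
    brings at least d + 1. This makes the differential preserve continuity. *)
Lemma Ld_bracket_order r x y :
  Ld_val x \in vf_order r -> Ld_val (Ld_bracket x y) \in vf_order r.
Proof.
move=> /asboolP x0; have /asboolP y0 := Ld_valP y; apply/asboolP => i m lt_m.
rewrite Ld_val_bracket /vf_bracket fct_sumE big1 // => j _.
rewrite fpsBE.
rewrite (@fps_mul_order r.+1 d) ?(@fps_mul_order d.+1 r) ?subrr //; try lia.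
- by move=> m' lt_m'; apply: y0.
- by move=> m' lt_m'; rewrite /fps_deriv x0 ?mul0rn // mdegD mdeg1 addn1.
- by move=> m' lt_m'; apply: x0.
- by move=> m' lt_m'; rewrite /fps_deriv y0 ?mul0rn // mdegD mdeg1 addn1.
Qed.

Variable l : 'I_n.

Definition shiftm u v (m : 'X_{1..n}) : 'X_{1..n} :=
  [multinom (if i == l then m i + u - v else m i)%N | i < n].

Lemma mdeg_split u v m : exists r,
  mdeg m = (m l + r)%N /\ mdeg (shiftm u v m) = (m l + u - v + r)%N.
Proof.
exists (\sum_(i | i != l) m i)%N; rewrite !mdegE.
split; rewrite (bigD1 l) //= ?mnmE; congr (_ + _)%N; rewrite ?eqxx //.
by apply: eq_bigr => i /negPf il; rewrite mnmE il.
Qed.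

Lemma mdeg_shiftm u v m : (v <= m l + u)%N -> (mdeg (shiftm u v m) + v = mdeg m + u)%N.
Proof. by move=> le_v; have [r [-> ->]] := mdeg_split u v m; lia. Qed.

Lemma mdeg_shiftm_le u v m : (mdeg (shiftm u v m) <= mdeg m + u)%N.
Proof. by have [r [-> ->]] := mdeg_split u v m; lia. Qed.

Lemma shiftmK u v m : (v <= m l + u)%N -> shiftm v u (shiftm u v m) = m.
Proof.
by move=> le_v; apply/mnmP => i; rewrite !mnmE; case: eqP => // ->; lia.
Qed.

Variable M : nat.

(* On monomials this is x^m d/dx_p |-> (m l - M) x^m x_l^(u - v) d/dx_p; the  *)
(* truncated subtraction makes it vanish where x_l^v does not divide.         *)
Definition Ld_shift u v x : Ld K n d :=
  Ld_proj d (fun p m => (m l + v - u - M)%:R * Ld_val x p (shiftm v u m)).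

Lemma Ld_shiftE u v x p m : Ld_val (Ld_shift u v x) p m =
  if (mdeg m < d.+1)%N then 0 else (m l + v - u - M)%:R * Ld_val x p (shiftm v u m).
Proof. by []. Qed.

Lemma Ld_shiftD u v (e : K) x y :
  Ld_shift u v (e *: x + y) = e *: Ld_shift u v x + Ld_shift u v y.
Proof.
apply: LdP => i m; rewrite Ld_valZD !Ld_shiftE; case: ifP => _; first by rewrite mulr0 addr0.
by rewrite Ld_valZD mulrDr mulrCA.
Qed.

Lemma Ld_shift_order u v r x :
  Ld_val x \in vf_order (r + v) -> Ld_val (Ld_shift u v x) \in vf_order r.
Proof.
move=> /asboolP x0; apply/asboolP => i m lt_m /=; case: ifP => // _.
rewrite x0 ?mulr0 // (leq_ltn_trans (mdeg_shiftm_le _ _ _)) //; lia.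
Qed.

Definition shift_mono u v (a : 'X_{1..n} * 'I_n) := (shiftm u v a.1, a.2).

(** For an exponent of x_l above [M] the shift is undone by the opposite one; for the others both
    sides vanish. *)
Lemma Ld_shift_mono u v a : (v <= M)%N -> valid d a ->
  Ld_shift u v (xmono K d a) = (a.1 l - M)%:R *: xmono K d (shift_mono u v a).
Proof.
move=> vM va; apply: LdP => i m.
rewrite -[RHS]/(_ * Ld_val _ i m).
rewrite Ld_shiftE.
rewrite -[Ld_val (xmono K d (shift_mono _ _ _)) i m]/(if (mdeg m < d.+1)%N then 0 else _).
case: ifP => _; first by rewrite mulr0.
rewrite xmonoE //=; case: (i == a.2); last by rewrite !mulr0.
have [->|mE] := eqVneq m (shiftm u v a.1); rewrite /= ?mulr1 ?mulr0.
  rewrite mnmE eqxx; have [le_M|lt_M] := leqP (a.1 l) M.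
    rewrite (_ : (a.1 l - M = 0)%N); last by lia.
    rewrite (_ : (_ - M = 0)%N) ?mul0r //; lia.
  by rewrite shiftmK ?eqxx ?mulr1; [congr (_%:R); lia | lia].
have [mE'|] := eqVneq (shiftm v u m) a.1; rewrite ?mulr0 // mulr1.
rewrite (_ : (_ - M = 0)%N) //; apply/eqP; rewrite subn_eq0 leqNgt.
apply: contra mE => lt_M; rewrite -mE' shiftmK //; lia.
Qed.

End LdOperations.

(** * The Chevalley-Eilenberg differential *)

(** [upd] and [consf] are convertible to the updates in [multilinear] and to [cons_arg], but also
    apply to families of monomial indices. *)
Definition upd (T : Type) k (x : 'I_k -> T) (i : 'I_k) (u : T) : 'I_k -> T :=
  fun j => if j == i then u else x j.

Definition consf (T : Type) k (u : T) (x : 'I_k -> T) : 'I_k.+1 -> T :=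
  fun l => if unlift ord0 l is Some p then x p else u.

Section Families.
Variables (T : Type).
Implicit Types (u v : T).

Lemma upd_same k (x : 'I_k -> T) i u : upd x i u i = u.
Proof. by rewrite /upd eqxx. Qed.

Lemma upd_upd k (x : 'I_k -> T) i u v : upd (upd x i u) i v = upd x i v.
Proof. by apply/funext => j; rewrite /upd; case: eqP. Qed.

Lemma updC k (x : 'I_k -> T) i j u v : i != j -> upd (upd x i u) j v = upd (upd x j v) i u.
Proof.
move=> ij; apply/funext => p; rewrite /upd.
by case: (eqVneq p j) => // ->; rewrite eq_sym (negPf ij).
Qed.

Lemma upd_id k (x : 'I_k -> T) i : upd x i (x i) = x.
Proof. by apply/funext => j; rewrite /upd; case: eqP => // ->. Qed.

Lemma consf0 k (x : 'I_k -> T) u : consf u x ord0 = u.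
Proof. by rewrite /consf unlift_none. Qed.

Lemma consfS k (x : 'I_k -> T) u p : consf u x (lift ord0 p) = x p.
Proof. by rewrite /consf liftK. Qed.

Lemma upd_inj k k' (x : 'I_k -> T) (f : 'I_k' -> 'I_k) i u :
  injective f -> upd x (f i) u \o f = upd (x \o f) i u.
Proof. by move=> fI; apply/funext => j; rewrite /upd /= (inj_eq fI). Qed.

Lemma upd_notin k k' (x : 'I_k -> T) (f : 'I_k' -> 'I_k) i u :
  (forall j, f j != i) -> upd x i u \o f = x \o f.
Proof. by move=> fi; apply/funext => j; rewrite /upd /= (negPf (fi j)). Qed.

Lemma upd_consf0 k (x : 'I_k -> T) u v : upd (consf u x) ord0 v = consf v x.
Proof.
apply/funext => j; rewrite /upd; case: (unliftP ord0 j) => [p|] ->.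
  by rewrite lift_eqF !consfS.
by rewrite eqxx consf0.
Qed.

Lemma upd_consfS k (x : 'I_k -> T) i u v :
  upd (consf u x) (lift ord0 i) v = consf u (upd x i v).
Proof.
apply/funext => j; rewrite /upd; case: (unliftP ord0 j) => [p|] ->.
  by rewrite (inj_eq lift_inj) !consfS.
by rewrite !consf0.
Qed.

Lemma consf_lift_perm k (x : 'I_k.+1 -> T) j u :
  consf u (x \o lift j) \o lift_perm j ord0 1 = upd x j u.
Proof.
apply/funext => i; rewrite /= /upd; case: (unliftP j i) => [p|] ->.
  by rewrite lift_perm_lift perm1 consfS eq_sym (negPf (neq_lift _ _)).
by rewrite lift_perm_id consf0 eqxx.
Qed.

Lemma map_upd (U : Type) (f : U -> T) k (b : 'I_k -> U) i z : f \o upd b i z = upd (f \o b) i (f z).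
Proof. by apply/funext => p; rewrite /upd /=; case: eqP. Qed.

Lemma map_consf (U : Type) (f : U -> T) k (b : 'I_k -> U) z : f \o consf z b = consf (f z) (f \o b).
Proof. by apply/funext => p; rewrite /consf /=; case: unlift. Qed.

Lemma lift_lift0 k (i : 'I_k.+1) (j : 'I_k) :
  lift (lift ord0 i) (lift ord0 j) = lift ord0 (lift i j).
Proof. by apply: val_inj; rewrite /= /bump !leq0n !add1n ltnS addnS. Qed.

Lemma lift_ord0 k (j : 'I_k.+1) : lift (lift ord0 j) ord0 = ord0.
Proof. by apply: val_inj. Qed.

End Families.

Lemma lift_perm_bij n : bijective (fun p : 'I_n.+1 * 'S_n => lift_perm ord0 p.1 p.2).
Proof.
apply: inj_card_bij.
  move=> [j s] [j' s'] /= E; have jE : j = j'.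
    by have := congr1 (fun t : 'S__ => t ord0) E; rewrite !lift_perm_id.
  congr pair => //; apply/permP => p.
  have := congr1 (fun t : 'S__ => t (lift ord0 p)) E.
  by rewrite !lift_perm_lift jE => /lift_inj.
by rewrite card_prod !card_Sn card_ord factS.
Qed.

Lemma sum_perm_lift (V : zmodType) n (F : 'S_n.+1 -> V) :
  \sum_s F s = \sum_j \sum_t F (lift_perm ord0 j t).
Proof.
by rewrite pair_big /= (reindex _ (onW_bij _ (lift_perm_bij n))).
Qed.

Lemma sign_lift_perm (R : nzRingType) n (i j : 'I_n.+1) (s : 'S_n) :
  (-1) ^+ lift_perm i j s = (-1) ^+ (i + j) * (-1) ^+ s :> R.
Proof.
by rewrite odd_lift_perm signr_addb -[in RHS]signr_odd oddD.
Qed.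

Section Multilinear.
Variables (K : fieldType) (g : lmodType K).
Implicit Types (k : nat).

Lemma mlinD k (c : cochain g k) x i (e : K) u v : multilinear c ->
  c (upd x i (e *: u + v)) = e * c (upd x i u) + c (upd x i v).
Proof. exact. Qed.

Lemma mlin0 k (c : cochain g k) x i : multilinear c -> c (upd x i 0) = 0.
Proof.
by move=> lc; have := mlinD x i (-1) 0 0 lc; rewrite scaler0 addr0 mulN1r addNr.
Qed.

Lemma mlinZ k (c : cochain g k) x i (e : K) u : multilinear c ->
  c (upd x i (e *: u)) = e * c (upd x i u).
Proof. by move=> lc; rewrite -[_ *: _]addr0 mlinD // mlin0 // addr0. Qed.

Lemma mlin_sum k (c : cochain g k) x i I (r : seq I) (P : pred I) (v : I -> g) :
  multilinear c ->
  c (upd x i (\sum_(t <- r | P t) v t)) = \sum_(t <- r | P t) c (upd x i (v t)).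
Proof.
move=> lc; elim/big_rec2: _ => [|t y1 y2 _ <-]; first exact: mlin0.
by rewrite -[v t]scale1r mlinD // mul1r scale1r.
Qed.

Lemma mlinN k (c : cochain g k) x i u : multilinear c ->
  c (upd x i (- u)) = - c (upd x i u).
Proof. by move=> lc; rewrite -scaleN1r mlinZ // mulN1r. Qed.

Lemma mlin_consfD k (c : cochain g k.+1) x (e : K) u v : multilinear c ->
  c (consf (e *: u + v) x) = e * c (consf u x) + c (consf v x).
Proof. by move=> lc; rewrite -(upd_consf0 x 0 (_ + _)) mlinD // !upd_consf0. Qed.

Lemma mlin_consfZ k (c : cochain g k.+1) x (e : K) u : multilinear c ->
  c (consf (e *: u) x) = e * c (consf u x).
Proof. by move=> lc; rewrite -(upd_consf0 x 0 (_ *: _)) mlinZ // upd_consf0. Qed.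

Lemma mlin_consfN k (c : cochain g k.+1) x u : multilinear c ->
  c (consf (- u) x) = - c (consf u x).
Proof. by move=> lc; rewrite -(upd_consf0 x 0 (- u)) mlinN // upd_consf0. Qed.

Lemma mlin_consfB k (c : cochain g k.+1) x u v : multilinear c ->
  c (consf (u - v) x) = c (consf u x) - c (consf v x).
Proof. by move=> lc; rewrite -[u]scale1r mlin_consfD // mlin_consfN // mul1r scale1r. Qed.

Lemma mlin_perm k (c : cochain g k) (s : 'S_k) :
  multilinear c -> multilinear (fun x => c (x \o s)).
Proof.
move=> lc x i e u v.
have E w : [eta x with i |-> w] \o s = upd (x \o s) (s^-1%g i) w.
  by rewrite -upd_inj ?permKV //; exact: perm_inj.
by rewrite !E mlinD.
Qed.

Lemma skew_swap k (c : cochain g k.+2) u v x : skew_symmetric c ->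
  c (consf u (consf v x)) = - c (consf v (consf u x)).
Proof.
move=> sc; have := sc (consf u (consf v x)) (tperm ord0 (lift ord0 ord0)).
rewrite odd_tperm expr1 mulN1r => /(congr1 -%R); rewrite opprK => <-.
congr (- c _); apply/funext => p /=.
case: tpermP => [->|->|/eqP p0 /eqP p1]; rewrite ?consf0 ?consfS ?consf0 //.
case: (unliftP ord0 p) p0 p1 => [q|] -> // _.
by case: (unliftP ord0 q) => [r|] -> //; rewrite !consfS.
Qed.

End Multilinear.

(** * The differential as an alternation *)

Section Alternation.
Variables (K : fieldType) (charK0 : [pchar K] =i pred0) (g : lmodType K).
Variable br : g -> g -> g.
Hypothesis brC : forall x y, br x y = - br y x.

Lemma mulrnI_char0 m : (0 < m)%N -> injective (fun a : K => a *+ m).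
Proof.
move=> m0 a b /=; rewrite -[a *+ m]mulr_natr -[b *+ m]mulr_natr; apply: mulIf.
by move/pcharf0P: charK0 => ->; rewrite -lt0n.
Qed.

Definition alt k (c : cochain g k) : cochain g k := fun x =>
  \sum_(s : 'S_k) (-1) ^+ s * c (x \o s).

Lemma alt_perm k (c : cochain g k) (t : 'S_k) x :
  alt (fun y => c (y \o t)) x = (-1) ^+ t * alt c x.
Proof.
rewrite /alt mulr_sumr [RHS](reindex_inj (mulgI t)) /=.
apply: eq_bigr => s _; rewrite mulrA -signr_addb odd_permM addbA addbb /=.
by congr (_ * c _); apply/funext => i; rewrite /= permM.
Qed.

Lemma alt_skew k (c : cochain g k) : skew_symmetric (alt c).
Proof.
move=> x t; rewrite /alt mulr_sumr [RHS](reindex_inj (mulIg t)) /=.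
apply: eq_bigr => s _; rewrite mulrA -signr_addb odd_permM addbCA addbb addbF.
by congr (_ * c _); apply/funext => i; rewrite /= permM.
Qed.

Lemma alt_multilinear k (c : cochain g k) : multilinear c -> multilinear (alt c).
Proof.
move=> lc x i e u v; rewrite /alt mulr_sumr -big_split; apply: eq_bigr => s _ /=.
by rewrite (mlin_perm s lc) mulrDr mulrCA.
Qed.

Definition ce_head k (c : cochain g k.+1) : cochain g k.+2 := fun y =>
  c (consf (br (y ord0) (y (lift ord0 ord0))) (fun p => y (lift ord0 (lift ord0 p)))).

Lemma ce_head_swap k (c : cochain g k.+1) y : multilinear c ->
  ce_head c (y \o tperm ord0 (lift ord0 ord0)) = - ce_head c y.
Proof.
move=> lc; rewrite /ce_head /= tpermL tpermR brC mlin_consfN //.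
congr (- c (consf _ _)); apply/funext => p.
by rewrite tpermD ?lift_eqF ?neq_lift // (inj_eq lift_inj) neq_lift.
Qed.

(** The permutation sends 0 to j, 1 to i, and enumerates the other indices increasingly. It puts x_j
    before x_i in the bracket, whence the global sign. *)
Lemma ce_diff_head k (c : cochain g k.+1) x : multilinear c ->
  ce_diff br c x = - \sum_(j < k.+2) \sum_(i < k.+1 | (i < j)%N)
    (-1) ^+ (lift_perm ord0 j (lift_perm ord0 i 1)) *
    ce_head c (x \o lift_perm ord0 j (lift_perm ord0 i 1)).
Proof.
move=> lc; rewrite /= -sumrN; apply: eq_bigr => j _.
rewrite -sumrN; apply: eq_bigr => i _.
rewrite !sign_lift_perm odd_perm1 mulr1 -exprD addnC -mulrN.
congr (_ * _); rewrite /ce_head /= lift_perm_id !lift_perm_lift lift_perm_id brC.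
rewrite mlin_consfN //; congr (- c (consf _ _)).
by apply/funext => p; rewrite !lift_perm_lift perm1.
Qed.

(* The differential is, up to a nonzero integer, the alternation of           *)
(* c([x0, x1], x2, ...): this makes skew symmetry and d^2 = 0 transparent.    *)
Lemma ce_diff_alt k (c : cochain g k.+1) x : multilinear c -> skew_symmetric c ->
  ce_diff br c x *+ (2 * k`!) = - alt (ce_head c) x.
Proof.
move=> lc sc; pose F (s : 'S_k.+2) := (-1) ^+ s * ce_head c (x \o s).
pose t := tperm (ord0 : 'I_k.+2) (lift ord0 ord0).
have Ft s : F (t * s)%g = F s.
  rewrite /F odd_permM odd_tperm signr_addb /= expr1 mulN1r mulNr -mulrN; congr (_ * _).
  rewrite -ce_head_swap //; congr ce_head; apply/funext => p /=.
  by rewrite permM tpermK.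
have Fs j i s : F (lift_perm ord0 j (lift_perm ord0 i s)) = F (lift_perm ord0 j (lift_perm ord0 i 1)).
  rewrite /F !sign_lift_perm odd_perm1 mulr1 -!mulrA; congr (_ * (_ * _)).
  rewrite /ce_head /= !(lift_perm_id, lift_perm_lift).
  set w := br _ _; set y := fun p => x _; set z := fun p => x _.
  have -> : consf w y = consf w z \o lift_perm ord0 ord0 s.
    apply/funext => p /=; case: (unliftP ord0 p) => [q|] ->.
      by rewrite lift_perm_lift !consfS /y /z !lift_perm_lift perm1.
    by rewrite lift_perm_id !consf0.
  by rewrite sc sign_lift_perm mul1r mulrA -signr_addb addbb mul1r.
have FE (P : pred 'S_k.+2) : \sum_(s | P s) F s = \sum_j \sum_i \sum_s
    if P (lift_perm ord0 j (lift_perm ord0 i s)) then F (lift_perm ord0 j (lift_perm ord0 i 1)) else 0.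
  rewrite big_mkcond sum_perm_lift; apply: eq_bigr => j _.
  by rewrite sum_perm_lift; apply: eq_bigr => i _; apply: eq_bigr => s _; rewrite Fs.
(* [P] selects the permutations with i < j. Exchanging the two bracketed arguments matches them with
   the others, whence the factor 2; the factor k! counts the orders of the remaining arguments. *)
pose P (s : 'S_k.+2) := (s (lift ord0 ord0) < s ord0)%N.
have altE : alt (ce_head c) x = (\sum_(s | P s) F s) *+ 2.
  rewrite /alt (bigID P) /= mulr2n; congr (_ + _).
  rewrite (reindex_inj (mulgI t)) /=; apply: eq_big => [s|s _]; last exact: Ft.
  rewrite /P !permM tpermL tpermR -leqNgt ltn_neqAle andbC.
  by rewrite (inj_eq val_inj) (inj_eq perm_inj) andb_idr // => _; rewrite eq_sym neq_lift.
rewrite altE FE mulnC mulrnA -mulNrn; congr (_ *+ 2).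
rewrite ce_diff_head // mulNrn; congr (- _).
rewrite -sumrMnl; apply: eq_bigr => j _.
rewrite -sumrMnl [LHS]big_mkcond; apply: eq_bigr => i _ /=.
rewrite /P; under eq_bigr do rewrite lift_perm_id lift_perm_lift lift_perm_id.
have -> : (lift j i < j)%N = (i < j)%N by rewrite /= /bump; case: leqP; lia.
by case: ifP => _; rewrite sumr_const ?mul0rn // card_Sn.
Qed.

End Alternation.

Section Differential.
Variables (K : fieldType) (charK0 : [pchar K] =i pred0) (g : lmodType K).
Variable br : g -> g -> g.
Hypothesis brC : forall x y, br x y = - br y x.
Hypothesis brDl : forall (e : K) x y z, br (e *: x + y) z = e *: br x z + br y z.

Let brDr (e : K) x y z : br z (e *: x + y) = e *: br z x + br z y.
Proof. by rewrite brC brDl opprD -scalerN -!brC. Qed.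

Lemma ce_head_multilinear k (c : cochain g k.+1) : multilinear c ->
  multilinear (ce_head br c).
Proof.
move=> lc x i e u v.
change (ce_head br c (upd x i (e *: u + v)) =
  e * ce_head br c (upd x i u) + ce_head br c (upd x i v)); rewrite /ce_head.
have rest w : (fun p => upd x i w (lift ord0 (lift ord0 p))) =
  upd x i w \o (lift ord0 \o lift ord0) by [].
have inj2 : injective (lift ord0 \o lift ord0 : 'I_k -> 'I_k.+2).
  exact: inj_comp lift_inj lift_inj.
case: (unliftP ord0 i) rest => [j|] ->; last first.
  move=> rest; rewrite !rest !upd_notin => [|p]; rewrite ?lift_eqF //.
  by rewrite !upd_same /upd !lift_eqF brDl mlin_consfD.
case: (unliftP ord0 j) => [p|] -> rest; last first.
  rewrite !rest !upd_notin => [|p]; rewrite ?(inj_eq lift_inj) ?lift_eqF //.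
  by rewrite !upd_same /upd !eq_liftF brDr mlin_consfD.
rewrite !rest !(upd_inj _ _ _ inj2) -!upd_consfS /upd !(inj_eq lift_inj) !eq_liftF.
by rewrite -/(upd _ _ _) mlinD.
Qed.

Lemma ce_diff_multilinear k (c : cochain g k) :
  multilinear c -> skew_symmetric c -> multilinear (ce_diff br c).
Proof.
case: k c => [|k] c lc sc x i e u v; first by rewrite /= mulr0 addr0.
apply: (@mulrnI_char0 _ charK0 (2 * k`!)); first by rewrite muln_gt0 fact_gt0.
rewrite mulrnDl -mulrnAr !ce_diff_alt //.
by rewrite (alt_multilinear (ce_head_multilinear lc)) opprD mulrN.
Qed.

Lemma ce_diff_skew k (c : cochain g k) :
  multilinear c -> skew_symmetric c -> skew_symmetric (ce_diff br c).
Proof.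
case: k c => [|k] c lc sc x s; first by rewrite /= mulr0.
apply: (@mulrnI_char0 _ charK0 (2 * k`!)); first by rewrite muln_gt0 fact_gt0.
by rewrite -mulrnAr !ce_diff_alt // alt_skew mulrN.
Qed.

Lemma cons_argE k u (x : 'I_k -> g) : cons_arg u x = consf u x.
Proof. by []. Qed.

Lemma alt_sum k I (r : seq I) (P : pred I) (c : I -> cochain g k) x :
  alt (fun y => \sum_(t <- r | P t) c t y) x = \sum_(t <- r | P t) alt (c t) x.
Proof.
rewrite /alt exchange_big; apply: eq_bigr => s _.
by rewrite mulr_sumr.
Qed.

Lemma alt_scale k (e : K) (c : cochain g k) x : alt (fun y => e * c y) x = e * alt c x.
Proof. by rewrite /alt mulr_sumr; apply: eq_bigr => s _; rewrite mulrCA. Qed.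

Lemma alt_eq0_swap k (c : cochain g k) (t : 'S_k) x :
  odd_perm t = false -> (forall y, c (y \o t) = - c y) -> alt c x = 0.
Proof.
move=> t0 ct; have := alt_perm c t x; rewrite t0 mul1r.
under [in X in X = _ -> _]eq_fun do rewrite ct.
have -> : alt (fun y => - c y) x = - alt c x.
  by rewrite /alt -sumrN; apply: eq_bigr => s _; rewrite mulrN.
move=> E; apply: (@mulrnI_char0 _ charK0 2) => //=.
by rewrite mul0rn mulr2n -{1}E addNr.
Qed.

(** Up to a nonzero integer this is an alternation of terms with two brackets, either on disjoint
    pairs or nested; each term alternates to 0. The Jacobi identity is assumed only for the entries
    of [x], so that it may be checked on monomials. *)
Lemma ce_diffK k (c : cochain g k) (x : 'I_k.+2 -> g) :
  multilinear c -> skew_symmetric c ->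
  (forall i j l, br (br (x i) (x j)) (x l) + br (br (x j) (x l)) (x i) +
                 br (br (x l) (x i)) (x j) = 0) ->
  ce_diff br (ce_diff br c) x = 0.
Proof.
case: k c x => [|k] c x lc sc jac.
  by rewrite /= big1 // => j _; rewrite big1 // => i _; rewrite mulr0.
have ld := ce_diff_multilinear lc sc; have sd := ce_diff_skew lc sc.
apply: (@mulrnI_char0 _ charK0 (2 * k.+1`!)); first by rewrite muln_gt0 fact_gt0.
rewrite mul0rn ce_diff_alt //; apply/eqP; rewrite oppr_eq0; apply/eqP.
pose Y (y : 'I_k.+3 -> g) := consf (br (y ord0) (y (lift ord0 ord0))) (y \o lift ord0 \o lift ord0).
have headE y : ce_head br (ce_diff br c) y = \sum_(j < k.+2) \sum_(i < k.+1 | (i < j)%N)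
    (-1) ^+ (i + j) * c (consf (br (Y y (lift j i)) (Y y j)) (fun p => Y y (lift j (lift i p)))).
  by [].
rewrite (funext headE).
rewrite alt_sum big1 // => j _; rewrite alt_sum big1 // => i ij.
rewrite alt_scale; apply/eqP; rewrite mulf_eq0; apply/orP; right; apply/eqP.
case: (unliftP ord0 j) ij => [j' ->|-> //].
case: (unliftP ord0 i) => [i'|] -> ij.
  move: c x lc sc jac ld sd @Y headE {j i} j' i' ij.
  case: k => [|k] c x lc sc jac ld sd Y headE j' i' ij; first by case: i' {ij}.
  (* Disjoint brackets: exchanging the two pairs is an even permutation, but by skew symmetry of [c]
     it changes the sign. *)
  pose a := lift ord0 (lift ord0 (lift j' i')) : 'I_k.+4.
  pose b := lift ord0 (lift ord0 j') : 'I_k.+4.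
  pose o1 := lift ord0 ord0 : 'I_k.+4.
  have ab : a != b by rewrite !(inj_eq lift_inj) lift_eqF.
  have E y : c (consf (br (Y y (lift (lift ord0 j') (lift ord0 i'))) (Y y (lift ord0 j')))
      (fun p => Y y (lift (lift ord0 j') (lift (lift ord0 i') p)))) =
    c (consf (br (y a) (y b)) (consf (br (y ord0) (y o1))
      (fun p => y (lift ord0 (lift ord0 (lift j' (lift i' p))))))).
    rewrite lift_lift0 /Y !consfS; congr (c (consf _ _)); apply/funext => p.
    case: (unliftP ord0 p) => [q|] ->; last by rewrite !lift_ord0 !consf0.
    by rewrite !lift_lift0 !consfS.
  have o0a : ord0 != a by rewrite neq_lift.
  have o0b : ord0 != b by rewrite neq_lift.
  have o01 : ord0 != o1 by rewrite neq_lift.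
  have o1a : o1 != a by rewrite (inj_eq lift_inj) neq_lift.
  have o1b : o1 != b by rewrite (inj_eq lift_inj) neq_lift.
  set t := (tperm ord0 a * tperm o1 b)%g.
  have ta : t a = ord0 by rewrite permM tpermR tpermD // eq_sym.
  have tb : t b = o1 by rewrite permM [tperm ord0 a b]tpermD ?tpermR.
  have t0 : t ord0 = a by rewrite permM tpermL tpermD // eq_sym.
  have t1 : t o1 = b by rewrite permM [tperm ord0 a o1]tpermD ?tpermL // eq_sym.
  apply: (@alt_eq0_swap _ _ t) => [|y].
    by rewrite odd_permM !odd_tperm ?o0a ?o1b.
  rewrite !E skew_swap // /= ta tb t0 t1; congr (- c (consf _ (consf _ _))).
  by apply/funext => p; rewrite permM !tpermD ?neq_lift ?(inj_eq lift_inj) ?neq_lift.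
(* Nested brackets: the cyclic permutation [t] of the three arguments is even, so three times the
   alternation is the alternation of a Jacobi sum. *)
pose b := lift ord0 (lift ord0 j') : 'I_k.+3.
pose o1 := lift ord0 ord0 : 'I_k.+3.
pose H y (u v w : 'I_k.+3) := c (consf (br (br (y u) (y v)) (y w))
   (fun p => y (lift ord0 (lift ord0 (lift j' p))))).
have E : (fun y => c (consf (br (Y y (lift (lift ord0 j') ord0)) (Y y (lift ord0 j')))
      (fun p => Y y (lift (lift ord0 j') (lift ord0 p))))) = (fun y => H y ord0 o1 b).
  apply/funext => y; rewrite lift_ord0 /Y consf0 !consfS; congr (c (consf _ _)); apply/funext => p.
  by rewrite lift_lift0 consfS.
rewrite E; pose t := (tperm ord0 o1 * tperm ord0 b)%g.
have o01 : ord0 != o1 by rewrite neq_lift.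
have o0b : ord0 != b by rewrite neq_lift.
have o1b : o1 != b by rewrite (inj_eq lift_inj) neq_lift.
have ot : odd_perm t = false by rewrite odd_permM !odd_tperm ?o01 ?o0b.
have t0 : t ord0 = o1 by rewrite permM tpermL tpermD // eq_sym.
have t1 : t o1 = b by rewrite permM tpermR tpermL.
have tb : t b = ord0 by rewrite permM [tperm ord0 o1 b]tpermD ?tpermR.
have tr p : t (lift ord0 (lift ord0 (lift j' p))) = lift ord0 (lift ord0 (lift j' p)).
  by rewrite permM !tpermD ?neq_lift ?(inj_eq lift_inj) ?neq_lift.
have Ht y u v w : H (y \o t) u v w = H y (t u) (t v) (t w).
  by rewrite /H /=; under eq_fun do rewrite tr.
have altt (F : cochain g _) : alt (fun y => F (y \o t)) x = alt F x.
  by rewrite alt_perm ot mul1r.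
have A1 : alt (fun y => H y o1 b ord0) x = alt (fun y => H y ord0 o1 b) x.
  rewrite -[RHS]altt; congr (alt _ x).
  by apply/funext => y; rewrite Ht t0 t1 tb.
have A2 : alt (fun y => H y b ord0 o1) x = alt (fun y => H y o1 b ord0) x.
  rewrite -[RHS]altt; congr (alt _ x).
  by apply/funext => y; rewrite Ht t0 t1 tb.
have : alt (fun y => H y ord0 o1 b) x + alt (fun y => H y o1 b ord0) x +
       alt (fun y => H y b ord0 o1) x = 0.
  rewrite /alt -!big_split big1 // => s _ /=.
  rewrite -!mulrDr /H /=; set r := fun p => _.
  have l2 u v : c (consf u r) + c (consf v r) = c (consf (u + v) r).
    by rewrite -{2}[u]scale1r mlin_consfD // mul1r.
  by rewrite !l2 jac -(upd_consf0 r 0) mlin0 ?mulr0.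
rewrite A2 A1 => E3; apply: (@mulrnI_char0 _ charK0 3) => //=.
by rewrite mul0rn -[RHS]E3 !mulrS mulr0n addr0 addrA.
Qed.

(* Cartan's formula d i_e + i_e d = theta_e, for a cocycle. *)
Lemma ce_diff_contract k (c : cochain g k.+1) e x :
  skew_symmetric c -> (forall y, ce_diff br c y = 0) ->
  ce_diff br (fun y => c (consf e y)) x = - \sum_q c (upd x q (br e (x q))).
Proof.
move=> sc dc; pose X := consf e x.
pose T (j : 'I_k.+2) (i : 'I_k.+1) := (-1) ^+ (i + j) * c (consf (br (X (lift j i)) (X j)) (fun p => X (lift j (lift i p)))).
have : \sum_(j < k.+2) \sum_(i < k.+1 | (i < j)%N) T j i = 0 by exact: dc.
have T0 (j : 'I_k.+1) : T (lift ord0 j) ord0 = - c (upd x j (br e (x j))).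
  rewrite /T add0n lift0 exprS mulN1r mulNr; congr (- _).
  rewrite /X lift_ord0 consf0 consfS -consf_lift_perm sc sign_lift_perm odd_perm1 mulr1 addn0.
  by congr (_ * c (consf _ _)); apply/funext => p /=; rewrite lift_lift0 consfS.
rewrite big_ord_recl big1 ?add0r => [|i]; last by rewrite ltn0.
(* The terms with i = 0 are those that bracket with [e]; the others form the differential of the
   contraction. When [c] has one argument, its contraction is a constant, with differential 0 by
   definition. *)
case: k c x sc dc @X @T T0 => [|k] c x sc dc X T T0.
  under eq_bigr => j _ do rewrite big_mkcond big_ord1 T0.
  by rewrite sumrN => ->.
have -> : ce_diff br (fun y => c (consf e y)) x = \sum_(j < k.+2) \sum_(i < k.+1 | (i < j)%N)
    (-1) ^+ (i + j) * c (consf e (consf (br (x (lift j i)) (x j)) (fun p => x (lift j (lift i p))))).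
  by [].
move=> E; apply/eqP; rewrite -addr_eq0 addrC -oppr_eq0 -[X in _ == X]E.
apply/eqP; rewrite opprD -!sumrN -big_split; apply: eq_bigr => j _.
rewrite [in RHS]big_mkcond big_ord_recl T0; congr (_ + _).
rewrite -big_mkcond -sumrN; apply: eq_big => [i|i ij]; first by rewrite !lift0 ltnS.
rewrite /T !lift0 addSn addnS !exprS !mulN1r opprK -mulrN /X lift_lift0 !consfS.
rewrite skew_swap // opprK; congr (_ * c (consf _ _)); apply/funext => p.
case: (unliftP ord0 p) => [q|] ->; first by rewrite !lift_lift0 !consfS.
by rewrite !lift_ord0 !consf0.
Qed.

End Differential.

(** * Operators of polynomial growth on tuples of monomials *)

Section Combinations.
Variables (K : fieldType) (T : Type).
Implicit Types (P : T -> bool) (F : (T -> K) -> K).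

(** The coefficients are integers because [N] bounds the sum of their absolute values, which has no
    meaning in K. For an operator evaluated at a tuple this is a bound on a row of its matrix. *)
Definition int_comb P (N : nat) F := exists s : seq (int * T),
  [/\ all (fun p => P p.2) s, (\sum_(p <- s) `|p.1|%N <= N)%N &
      forall f, F f = \sum_(p <- s) p.1%:~R * f p.2].

Lemma int_comb0 P N : int_comb P N (fun=> 0).
Proof. by exists [::]; split=> // [|f]; rewrite big_nil. Qed.

Lemma int_comb_ext P N F G : (forall f, F f = G f) -> int_comb P N F -> int_comb P N G.
Proof. by move=> FG [s [Ps sN sF]]; exists s; split=> // f; rewrite -FG. Qed.

Lemma int_comb_leq P N N' F : (N <= N')%N -> int_comb P N F -> int_comb P N' F.
Proof. by move=> NN' [s [Ps sN sF]]; exists s; split=> //; apply: leq_trans NN'. Qed.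

(** [P] is asked only where the coefficient is nonzero, since truncated shifts may lead to
    meaningless indices with coefficient 0. *)
Lemma int_comb_point P N (z : int) t : (z != 0 -> P t) -> (`|z| <= N)%N ->
  int_comb P N (fun f => z%:~R * f t).
Proof.
have [-> _ _|z0 /(_ isT) Pt zN] := eqVneq z 0.
  by apply: int_comb_ext (int_comb0 _ _) => f; rewrite mul0r.
by exists [:: (z, t)]; split=> [||f]; rewrite /= ?Pt ?big_seq1.
Qed.

Lemma int_combD P N N' F G : int_comb P N F -> int_comb P N' G ->
  int_comb P (N + N') (fun f => F f + G f).
Proof.
move=> [s [Ps sN sF]] [t [Pt tN tG]]; exists (s ++ t); split=> [||f].
- by rewrite all_cat Ps.
- by rewrite big_cat leq_add.
- by rewrite big_cat sF tG.
Qed.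

Lemma int_combZ P N (z : int) F : int_comb P N F -> int_comb P (`|z| * N) (fun f => z%:~R * F f).
Proof.
move=> [s [Ps sN sF]]; exists [seq (z * p.1, p.2) | p <- s]; split=> [||f].
- by rewrite all_map.
- rewrite big_map; under eq_bigr do rewrite abszM.
  by rewrite -big_distrr leq_mul.
- by rewrite sF big_map mulr_sumr; apply: eq_bigr => p _; rewrite intrM mulrA.
Qed.

Lemma int_combN P N F : int_comb P N F -> int_comb P N (fun f => - F f).
Proof.
move=> /(int_combZ (-1)) cF; rewrite -[N]mul1n; apply: int_comb_ext cF => f.
by rewrite mulN1r.
Qed.

Lemma int_comb_sign P N j F : int_comb P N F -> int_comb P N (fun f => (-1) ^+ j * F f).
Proof.
move=> cF; rewrite -signr_odd; case: (odd j).
  by apply: int_comb_ext (int_combN cF) => f; rewrite expr1 mulN1r.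
by apply: int_comb_ext cF => f; rewrite mul1r.
Qed.

Lemma int_comb_sum P N I (r : seq I) (Q : pred I) (F : I -> (T -> K) -> K) :
  (forall i, Q i -> int_comb P N (F i)) ->
  int_comb P (size r * N) (fun f => \sum_(i <- r | Q i) F i f).
Proof.
move=> cF; elim: r => [|i r IHr].
  by apply: int_comb_ext (int_comb0 _ _) => f; rewrite big_nil.
have [Qi|Qi] := boolP (Q i).
  rewrite mulSn; apply: int_comb_ext (int_combD (cF i Qi) IHr) => f.
  by rewrite big_cons Qi.
apply: int_comb_leq (_ : size r * N <= _)%N _; first by rewrite leq_mul.
by apply: int_comb_ext IHr => f; rewrite big_cons (negPf Qi).
Qed.

Lemma int_comb_sumT P N (I : finType) (Q : pred I) (F : I -> (T -> K) -> K) :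
  (forall i, Q i -> int_comb P N (F i)) ->
  int_comb P (#|I| * N) (fun f => \sum_(i | Q i) F i f).
Proof.
move=> cF; have -> : #|I| = size (index_enum I) by rewrite cardT enumT.
exact: int_comb_sum.
Qed.

Lemma int_comb_eq P N F f g : int_comb P N F -> (forall t, P t -> f t = g t) -> F f = F g.
Proof.
move=> [s [Ps _ sF]] fg; rewrite !sF {sF}.
elim: s Ps => [|p s IHs] /=; first by rewrite !big_nil.
by case/andP=> Pp Ps; rewrite !big_cons fg ?IHs.
Qed.

End Combinations.

Lemma int_comb_bind (K : fieldType) (T T' : Type) P N F P' N' (G : T -> (T' -> K) -> K) :
  int_comb P N F -> (forall t, P t -> int_comb P' N' (G t)) ->
  int_comb P' (N * N') (fun f => F (fun t => G t f)).
Proof.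
move=> [s [Ps sN sF]] cG; apply: int_comb_leq (leq_mul sN (leqnn _)) _.
apply: int_comb_ext (_ : int_comb P' _ (fun f => \sum_(p <- s) p.1%:~R * G p.2 f)).
  by move=> f; rewrite sF.
elim: s Ps {sN sF} => [_|p s IHs /= /andP[Pp Ps]].
  by apply: int_comb_ext (int_comb0 _ _ _) => f; rewrite big_nil.
rewrite big_cons mulnDl.
apply: int_comb_ext (int_combD (int_combZ p.1 (cG _ Pp)) (IHs Ps)) => f.
by rewrite big_cons.
Qed.

Section Tuples.
Variables (K : fieldType) (n d : nat).

Definition mono_index := ('X_{1..n} * 'I_n)%type.
Definition tup k := 'I_k -> mono_index.
Definition tupfun k := tup k -> K.
Implicit Types (x y z : mono_index).

Definition vtup k (b : tup k) := [forall i, valid d (b i)].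
Definition wt k (b : tup k) := (\sum_i (mdeg (b i).1).-1)%N.

Lemma vtupP k (b : tup k) : reflect (forall i, valid d (b i)) (vtup b).
Proof. exact: forallP. Qed.

Lemma mdeg_le_wt k (b : tup k) i : (mdeg (b i).1 <= (wt b).+1)%N.
Proof. by rewrite /wt (bigD1 i) //=; lia. Qed.

Lemma coord_le_wt k (b : tup k) i l : ((b i).1 l <= (wt b).+1)%N.
Proof.
by apply: leq_trans (mdeg_le_wt b i); rewrite mdegE (bigD1 l) //= leq_addr.
Qed.

Lemma wt_upd k (b : tup k) i z :
  (wt (upd b i z) + (mdeg (b i).1).-1 = wt b + (mdeg z.1).-1)%N.
Proof.
rewrite /wt (bigD1 i) //= upd_same [in RHS](bigD1 i) //=.
rewrite (eq_bigr (fun j => (mdeg (b j).1).-1)) => [|j /negPf ji]; last by rewrite /upd ji.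
by lia.
Qed.

Lemma wt_consf k (b : tup k) z : wt (consf z b) = ((mdeg z.1).-1 + wt b)%N.
Proof.
by rewrite /wt big_ord_recl consf0; congr (_ + _)%N; apply: eq_bigr => i _; rewrite consfS.
Qed.

Lemma wt_lift k (b : tup k.+1) j : wt b = ((mdeg (b j).1).-1 + wt (b \o lift j))%N.
Proof. by rewrite /wt (bigD1_ord j). Qed.

Lemma vtup_upd k (b : tup k) i z : vtup b -> valid d z -> vtup (upd b i z).
Proof.
by move=> /vtupP vb vz; apply/vtupP => j; rewrite /upd; case: eqP.
Qed.

Lemma vtup_consf k (b : tup k) z : vtup b -> valid d z -> vtup (consf z b).
Proof.
move=> /vtupP vb vz; apply/vtupP => j.
by case: (unliftP ord0 j) => [p|] ->; rewrite ?consfS ?consf0.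
Qed.

Definition near k (b : tup k) (w : int) k' (b' : tup k') :=
  vtup b' && ((wt b')%:Z == (wt b)%:Z + w).

(* Operators whose value at b only involves tuples of weight wt b + w, with   *)
(* integral coefficients of polynomial growth of degree r in the weight.      *)
Definition growth k k' (r : nat) (w : int) (D : tupfun k -> tupfun k') := exists C : nat,
  forall b : tup k', vtup b -> int_comb (near b w (k' := k)) (C * (wt b).+1 ^ r) (fun f => D f b).

Lemma growth_ext k k' r w (D D' : tupfun k -> tupfun k') :
  (forall f b, vtup b -> D f b = D' f b) -> growth r w D -> growth r w D'.
Proof.
move=> DD' [C cD]; exists C => b vb.
by apply: int_comb_ext (cD b vb) => f; exact: DD'.
Qed.

Lemma growth_eq k k' r w (D : tupfun k -> tupfun k') f g b : growth r w D -> vtup b ->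
  (forall b', vtup b' -> f b' = g b') -> D f b = D g b.
Proof.
by move=> [C cD] vb fg; apply: (int_comb_eq (cD b vb)) => b' /andP[/fg].
Qed.

Lemma growth_leq k k' r r' w (D : tupfun k -> tupfun k') : (r <= r')%N -> growth r w D -> growth r' w D.
Proof.
move=> rr' [C cD]; exists C => b vb; apply: int_comb_leq (cD b vb).
by rewrite leq_mul2l leq_pexp2l ?orbT.
Qed.

Lemma growth_D k k' r w (D D' : tupfun k -> tupfun k') :
  growth r w D -> growth r w D' -> growth r w (fun f b => D f b + D' f b).
Proof.
move=> [C cD] [C' cD']; exists (C + C')%N => b vb.
by rewrite mulnDl; apply: int_combD; [apply: cD|apply: cD'].
Qed.

Lemma growth_N k k' r w (D : tupfun k -> tupfun k') : growth r w D -> growth r w (fun f b => - D f b).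
Proof. by move=> [C cD]; exists C => b vb; apply: int_combN; apply: cD. Qed.

Lemma growth_B k k' r w (D D' : tupfun k -> tupfun k') :
  growth r w D -> growth r w D' -> growth r w (fun f b => D f b - D' f b).
Proof. by move=> oD oD'; apply: growth_D => //; apply: growth_N. Qed.

Lemma growth_0 k k' r w : growth r w (fun (_ : tupfun k) (_ : tup k') => 0).
Proof. by exists 0%N => b _; apply: int_comb0. Qed.

Lemma growth_sign k k' r w j (D : tupfun k -> tupfun k') : growth r w D -> growth r w (fun f b => (-1) ^+ j * D f b).
Proof. by move=> [C cD]; exists C => b vb; apply: int_comb_sign; apply: cD. Qed.

Lemma growth_sum k k' r w I (s : seq I) (Q : pred I) (D : I -> tupfun k -> tupfun k') :
  (forall i, Q i -> growth r w (D i)) -> growth r w (fun f b => \sum_(i <- s | Q i) D i f b).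
Proof.
move=> oD; elim: s => [|i s IHs].
  by apply: growth_ext (growth_0 _ _ _ _) => f b _; rewrite big_nil.
have [Qi|Qi] := boolP (Q i).
  by apply: growth_ext (growth_D (oD i Qi) IHs) => f b _; rewrite big_cons Qi.
by apply: growth_ext IHs => f b _; rewrite big_cons (negPf Qi).
Qed.

Lemma growth_comp k1 k2 k3 r1 r2 w1 w2 (D1 : tupfun k1 -> tupfun k2) (D2 : tupfun k2 -> tupfun k3) :
  growth r2 w2 D2 -> growth r1 w1 D1 -> growth (r2 + r1) (w2 + w1) (fun f => D2 (D1 f)).
Proof.
(* The bound for [D1] holds at a tuple of weight wt b + w2; the extra factor brings it back to the
   weight of [b]. *)
move=> [C2 c2] [C1 c1]; exists (C2 * (C1 * (`|w2|.+1) ^ r1))%N => b vb.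
apply: int_comb_leq (int_comb_bind (c2 b vb) (P' := near b (w2 + w1) (k' := k1))
  (N' := C1 * (`|w2|.+1 * (wt b).+1) ^ r1) (G := fun b' f => D1 f b') _).
  by rewrite expnMn expnD; apply: eq_leq; ring.
move=> b' /andP[vb' /eqP wb'].
have [s [Ps sN sF]] := c1 b' vb'; exists s; split=> //.
  apply: sub_all Ps => p /andP[vp /eqP wp]; rewrite /near vp wp wb' /=; lia.
apply: leq_trans sN _; rewrite leq_mul2l; apply/orP; right.
have le_b' : ((wt b').+1 <= `|w2|.+1 * (wt b).+1)%N by move: wb'; nia.
by case: (posnP r1) => [->|r1_gt0]; rewrite ?expn0 ?leq_exp2r.
Qed.

End Tuples.

(** * Shift operators and the differential on tuples *)

Section TupleOperators.
Variables (K : fieldType) (n d : nat) (l : 'I_n) (M : nat).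
Local Notation mono_index := (mono_index n).
Local Notation tup k := (tup n k).
Local Notation tupfun k := (tupfun K n k).
Local Notation growth := (@growth K n d _ _).
Local Notation vtup := (@vtup n d _).
Implicit Types (x y z : mono_index).

(** It replaces the exponent of x_l, from which it differs by at most [M], hence not to leading
    order. As it vanishes unless the exponent exceeds [M], lowering the exponent never leaves the
    valid monomials with a nonzero coefficient. *)
Definition cut_exp x := (x.1 l - M)%N.
Definition bshift u v x : mono_index := shift_mono l u v x.

Definition shift_der k u v (f : tupfun k) : tupfun k := fun b =>
  \sum_q (cut_exp (b q))%:R * f (upd b q (bshift u v (b q))).

Lemma bshift_valid u v x : (v + d < x.1 l)%N ->
  valid d (bshift u v x) /\ ((mdeg (bshift u v x).1).-1 + v = (mdeg x.1).-1 + u)%N.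
Proof.
move=> lt_x; have le_v : (v <= x.1 l + u)%N by lia.
have le_x : (x.1 l <= mdeg x.1)%N by rewrite mdegE (bigD1 l) //= leq_addr.
have := mdeg_shiftm le_v; rewrite /valid /=; set m := mdeg (shiftm _ _ _ _).
by move=> E; split; lia.
Qed.

Lemma near_shift k (b : tup k) q u v : vtup b -> (v + d < (b q).1 l)%N ->
  near d b (u%:Z - v%:Z) (upd b q (bshift u v (b q))).
Proof.
move=> vb /(@bshift_valid u)[vq wq]; rewrite /near vtup_upd //=.
by have := wt_upd b q (bshift u v (b q)); lia.
Qed.

Lemma shift_der_growth k u v : (v + d <= M)%N -> growth 1 (u%:Z - v%:Z) (@shift_der k u v).
Proof.
move=> leM; exists k => b vb; rewrite expn1.
rewrite -[X in (X * _)%N](card_ord k).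
apply: (int_comb_sumT (F := fun q f => (cut_exp (b q))%:R * f (upd b q (bshift u v (b q))))) => q _.
apply: (@int_comb_point K _ _ _ (cut_exp (b q))%:Z).
  by rewrite /cut_exp => nz; apply: near_shift => //; lia.
by rewrite absz_nat (leq_trans (leq_subr _ _)) // coord_le_wt.
Qed.

Lemma shift_der_up k u v b (f : tupfun k) : (v <= u)%N -> shift_der u v f b = shift_der (u - v) 0 f b.
Proof.
move=> le_vu; apply: eq_bigr => q _; congr (_ * f (upd _ _ _)).
congr pair; apply/mnmP => i; rewrite !mnmE; case: eqP => // _; lia.
Qed.

Definition bracket_index x y : mono_index := ((x.1 + y.1 - U_(x.2))%MM, y.2).

Definition bracket_term k (f : tupfun k.+1) x y (r : tup k) : K :=
  (y.1 x.2)%:R * f (consf (bracket_index x y) r) - (x.1 y.2)%:R * f (consf (bracket_index y x) r).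

Definition tuple_diff k : tupfun k -> tupfun k.+1 :=
  match k with
  | 0 => fun _ _ => 0
  | k'.+1 => fun f b => \sum_(j < k'.+2) \sum_(i < k'.+1 | (i < j)%N)
      (-1) ^+ (i + j) * bracket_term f (b (lift j i)) (b j) (fun p => b (lift j (lift i p)))
  end.

(** The three terms of [shift_defect] end at the same index, so only the total coefficient [w]
    matters. Its quadratic part cancels: [cut_exp] is additive under the bracket up to a constant of
    order [M], and the shift changes an exponent by at most u + v. *)
Lemma bracket_index_shift u v x y : (v + d < M)%N -> valid d x -> valid d y ->
  let w := (y.1 x.2)%:Z * (cut_exp (bracket_index x y))%:Z - (cut_exp x)%:Z * (y.1 x.2)%:Z
           - (cut_exp y)%:Z * ((bshift u v y).1 x.2)%:Z in
  [/\ (y.1 x.2 * cut_exp x != 0)%N -> bracket_index (bshift u v x) y = bshift u v (bracket_index x y),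
      (cut_exp y != 0)%N -> bracket_index x (bshift u v y) = bshift u v (bracket_index x y),
      w != 0 -> valid d (bshift u v (bracket_index x y)) /\
        ((mdeg (bshift u v (bracket_index x y)).1).-1 + v = (mdeg x.1).-1 + (mdeg y.1).-1 + u)%N
    & (`|w| <= (mdeg y.1 + mdeg y.1) * (M.+1 + u + v))%N].
Proof.
move=> leM vx vy w.
have zE : (bracket_index x y).1 l = (x.1 l + y.1 l - (x.2 == l))%N.
  by rewrite /bracket_index /= !mnmE.
have syE : (bshift u v y).1 x.2 = (if x.2 == l then y.1 x.2 + u - v else y.1 x.2)%N.
  by rewrite /= mnmE.
have leyl : (y.1 l <= mdeg y.1)%N by rewrite mdegE (bigD1 l) //= leq_addr.
have leyx : (y.1 x.2 <= mdeg y.1)%N by rewrite mdegE (bigD1 x.2) //= leq_addr.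
split.
- rewrite muln_eq0 negb_or /cut_exp => /andP[y0 x0]; congr pair.
  apply/mnmP => i; rewrite !mnmE; case: (eqVneq i l) => [->|//].
  by case: eqP => [E|_] //=; move: y0; rewrite ?E; lia.
- rewrite /cut_exp => y0; congr pair; apply/mnmP => i; rewrite !mnmE.
  by case: (eqVneq i l) => [->|//]; case: eqP => _ /=; lia.
- move=> w0; have [yx zl] : (0 < y.1 x.2)%N /\ (M <= (bracket_index x y).1 l)%N.
    have chiE t : (t <= M)%N -> (t - M = 0)%N by rewrite -subn_eq0 => /eqP.
    have y0 : (0 < y.1 x.2)%N.
      rewrite lt0n; apply: contra_neqN w0 => /eqP y0.
      rewrite /w syE /cut_exp y0 mul0r mulr0; case: eqP => [E|_]; last by rewrite mulr0 !subr0.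
      by rewrite -E y0 chiE // mul0r !subr0.
    split=> //; rewrite leqNgt; apply: contra_neqN w0; rewrite zE => lt_z.
    have le_xl : (x.1 l <= M)%N by case: eqP lt_z => [E|_]; rewrite ?E in y0 *; lia.
    have le_yl : (y.1 l <= M)%N by case: eqP lt_z => _; lia.
    by rewrite /w /cut_exp zE !chiE ?(ltnW lt_z) // !mul0r mulr0 !subr0.
  have [vz wz] := @bshift_valid u v (bracket_index x y) (leq_trans leM zl).
  split=> //; rewrite wz /= mdeg_subU ?mdegD ?mnmDE; last by lia.
  by move: vx vy; rewrite /valid; lia.
- rewrite /w syE /cut_exp zE; case: eqP => [E|_] /=; rewrite -?E in leyl *; nia.
Qed.

Lemma shift_der_consf k u v (f : tupfun k.+1) z (r : tup k) : shift_der u v f (consf z r) =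
  (cut_exp z)%:R * f (consf (bshift u v z) r) +
  \sum_q (cut_exp (r q))%:R * f (consf z (upd r q (bshift u v (r q)))).
Proof.
rewrite /shift_der big_ord_recl consf0 upd_consf0; congr (_ + _).
by apply: eq_bigr => q _; rewrite consfS upd_consfS.
Qed.

Definition shift_defect k u v x y (r : tup k) (f : tupfun k.+1) : K :=
  (y.1 x.2)%:R * ((cut_exp (bracket_index x y))%:R * f (consf (bshift u v (bracket_index x y)) r))
  - (cut_exp x)%:R * ((y.1 x.2)%:R * f (consf (bracket_index (bshift u v x) y) r))
  - (cut_exp y)%:R * (((bshift u v y).1 x.2)%:R * f (consf (bracket_index x (bshift u v y)) r)).

Lemma bracket_term_shift k u v (f : tupfun k.+1) x y (r : tup k) :
  bracket_term (shift_der u v f) x y r -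
  ((cut_exp x)%:R * bracket_term f (bshift u v x) y r + (cut_exp y)%:R * bracket_term f x (bshift u v y) r +
   \sum_q (cut_exp (r q))%:R * bracket_term f x y (upd r q (bshift u v (r q)))) =
  shift_defect u v x y r f - shift_defect u v y x r f.
Proof.
rewrite /bracket_term /shift_defect !shift_der_consf.
set S1 := \sum_q _; set S2 := \sum_q _; set S3 := \sum_q _.
have -> : S3 = (y.1 x.2)%:R * S1 - (x.1 y.2)%:R * S2.
  rewrite !mulr_sumr -sumrB; apply: eq_bigr => q _.
  by rewrite mulrBr !mulrA ![(cut_exp (r q))%:R * _]mulrC.
by ring.
Qed.

(** [shift_der] acts on every argument as a derivation: the contributions of the arguments outside
    the bracket cancel, and those of the bracketed pair leave its failure to be a derivation of the
    bracket. *)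
Lemma tuple_diff_shift k u v (f : tupfun k.+1) b :
  tuple_diff (shift_der u v f) b - shift_der u v (tuple_diff f) b =
  \sum_(j < k.+2) \sum_(i < k.+1 | (i < j)%N) (-1) ^+ (i + j) *
    (shift_defect u v (b (lift j i)) (b j) (fun p => b (lift j (lift i p))) f
     - shift_defect u v (b j) (b (lift j i)) (fun p => b (lift j (lift i p))) f).
Proof.
rewrite /shift_der -/(shift_der u v f); under [X in _ - X]eq_bigr do rewrite mulr_sumr.
rewrite exchange_big /tuple_diff -sumrB; apply: eq_bigr => j _.
under [X in _ - X]eq_bigr do rewrite mulr_sumr.
rewrite exchange_big /= -sumrB; apply: eq_bigr => i ij.
rewrite -bracket_term_shift [RHS]mulrBr; congr (_ - _).
under eq_bigr do rewrite mulrCA.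
rewrite -mulr_sumr; congr (_ * _).
rewrite (bigD1_ord j) // (bigD1_ord i) //= addrA [X in X + _]addrC.
have updE t z g : (fun p => upd b t z (g p)) = upd b t z \o (g : 'I_k -> 'I_k.+2) by [].
have l2 : injective (lift j \o lift i) by apply: inj_comp lift_inj lift_inj.
congr (_ + _ + _).
- rewrite upd_same /upd eq_liftF; congr (_ * bracket_term _ _ _ _).
  by apply/funext => p; rewrite (inj_eq lift_inj) lift_eqF.
- rewrite upd_same /upd lift_eqF; congr (_ * bracket_term _ _ _ _).
  by apply/funext => p; rewrite lift_eqF.
- apply: eq_bigr => q _; congr (_ * bracket_term _ _ _ _).
  + by rewrite /upd (inj_eq lift_inj) eq_liftF.
  + by rewrite /upd eq_liftF.
  + by apply/funext => p; rewrite /upd !(inj_eq lift_inj).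
Qed.

Lemma shift_defect_comb k u v (b : tup k.+2) x y (r : tup k) : (v + d < M)%N ->
  vtup r -> valid d x -> valid d y -> wt b = ((mdeg x.1).-1 + ((mdeg y.1).-1 + wt r))%N ->
  int_comb (near d b (u%:Z - v%:Z) (k' := k.+1)) (2 * (M.+1 + u + v) * (wt b).+1)
    (shift_defect u v x y r).
Proof.
move=> leM vr vx vy wb; have [sx sy wz lew] := bracket_index_shift u leM vx vy.
set w := (X in X != 0) in wz; rewrite -/w in lew.
apply: (int_comb_ext (F := fun f => w%:~R * f (consf (bshift u v (bracket_index x y)) r))) => [f|].
  rewrite /shift_defect /w !rmorphB !rmorphM /= !mulrBl -!mulrA; congr (_ - _ - _).
    have [/eqP|/sx ->//] := eqVneq (y.1 x.2 * cut_exp x)%N 0%N.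
    by rewrite muln_eq0 => /orP[] /eqP ->; rewrite !(mul0r, mulr0).
  by have [->|/sy ->//] := eqVneq (cut_exp y) 0%N; rewrite !mul0r.
apply: int_comb_point => [w0|].
- have [vz wzE] := wz w0.
  rewrite /near vtup_consf //= wt_consf wb; lia.
- apply: leq_trans lew _; rewrite addnn -mul2n [leqRHS]mulnAC leq_mul // leq_mul2l /= wb.
  by move: vy; rewrite /valid; lia.
Qed.

(** Each of the two compositions has order 2 in the weight; the commutator gains one order. *)
Lemma tuple_diff_shift_growth k u v : (v + d < M)%N ->
  growth 1 (u%:Z - v%:Z) (fun (f : tupfun k) b => tuple_diff (shift_der u v f) b - shift_der u v (tuple_diff f) b).
Proof.
move=> leM; case: k => [|k].
  apply: growth_ext (growth_0 _ _ _ _ _ _ _) => f b _ /=.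
  by rewrite /shift_der big1 ?subr0 // => q _; rewrite mulr0.
pose G (b : tup k.+2) (j : 'I_k.+2) (i : 'I_k.+1) (f : tupfun k.+1) := (-1) ^+ (i + j) *
    (shift_defect u v (b (lift j i)) (b j) (fun p => b (lift j (lift i p))) f
     - shift_defect u v (b j) (b (lift j i)) (fun p => b (lift j (lift i p))) f).
have [C leC] : exists C, forall b, vtup b -> forall j i,
    int_comb (near d b (u%:Z - v%:Z) (k' := k.+1)) (C * (wt b).+1) (G b j i).
  exists (2 * (M.+1 + u + v) + 2 * (M.+1 + u + v))%N => b vb j i.
  have vr : vtup (fun p => b (lift j (lift i p))).
    by apply/vtupP => p; apply/(vtupP _ _ vb).
  apply: int_comb_sign; rewrite mulnDl; apply: int_combD; last apply: int_combN.
    apply: shift_defect_comb => //; try exact/(vtupP _ _ vb).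
    by rewrite (wt_lift b j) (wt_lift _ i) addnCA.
  apply: shift_defect_comb => //; try exact/(vtupP _ _ vb).
  by rewrite (wt_lift b j) (wt_lift _ i).
exists (#|'I_k.+2| * (#|'I_k.+1| * C))%N => b vb; rewrite expn1 -!mulnA.
refine (int_comb_ext (F := fun f => \sum_(j < k.+2) \sum_(i < k.+1 | (i < j)%N) G b j i f) _ _).
  by move=> f; exact: esym (tuple_diff_shift _ _ _ _).
apply: int_comb_sumT => j _; apply: (int_comb_sumT (F := G b j)) => i _; exact: leC.
Qed.

End TupleOperators.

Lemma sum_ffun_cons (V : zmodType) N (I : finType) (F : {ffun 'I_N.+1 -> I} -> V) :
  \sum_phi F phi = \sum_q \sum_(psi : {ffun 'I_N -> I}) F [ffun r => consf q psi r].
Proof.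
rewrite pair_big /= [LHS](reindex (fun p : I * {ffun 'I_N -> I} => [ffun r => consf p.1 p.2 r])) //.
apply: onW_bij; apply: inj_card_bij => [[q psi] [q' psi'] /ffunP E|]; last first.
  by rewrite card_prod !card_ffun !card_ord expnS.
congr pair; first by have := E ord0; rewrite !ffunE !consf0.
by apply/ffunP => r; have := E (lift ord0 r); rewrite !ffunE !consfS.
Qed.

(** * Words in the shifts and their leading parts *)

Section Words.
Variables (K : fieldType) (n d : nat) (l : 'I_n) (M : nat).
Local Notation mono_index := (mono_index n).
Local Notation tup k := (tup n k).
Local Notation tupfun k := (tupfun K n k).
Local Notation growth := (@growth K n d _ _).
Local Notation vtup := (@vtup n d _).
Local Notation cut := (cut_exp l M).
Local Notation bshift := (@bshift n l).
Local Notation shift_der := (@shift_der K n l M _).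
Implicit Types (x y z : mono_index).

Definition xpow i : mono_index := ((U_(l) *+ i.+1)%MM, l).

Definition lie_der i k (f : tupfun k) : tupfun k := fun b => \sum_q
  (((b q).1 l)%:R * f (upd b q (bracket_index (xpow i) (b q)))
   - ((xpow i).1 (b q).2)%:R * f (upd b q (bracket_index (b q) (xpow i)))).

(** Both operators shift the exponent of x_l by i; on each argument their coefficients differ by the
    cut-off and by the derivative of x_l^(i+1), which are bounded. *)
Lemma lie_der_growth i k :
  growth 0 i%:Z (fun (f : tupfun k) b => lie_der i f b - shift_der i 0 f b).
Proof.
exists (#|'I_k| * (M + i.+1))%N => b vb; rewrite expn0 muln1.
pose w q := ((b q).1 l)%:Z - (i.+1 * ((b q).2 == l))%:Z - (cut (b q))%:Z.
refine (int_comb_ext (F := fun f => \sum_q (w q)%:~R * f (upd b q (bshift i 0 (b q)))) _ _).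
  move=> f; rewrite /lie_der -sumrB; apply: eq_bigr => q _.
  have E1 : bracket_index (xpow i) (b q) = bshift i 0 (b q).
    congr pair; apply/mnmP => t; rewrite mnmBE mnmDE mulmnE mnm1E mnmE [l == t]eq_sym.
    by case: (t =P l) => [->|_] /=; lia.
  rewrite E1 /w !rmorphB /= !mulrBl; congr (_ - _ - _).
  have [E|ne] := eqVneq (b q).2 l; rewrite mulmnE mnm1E [l == _]eq_sym.
    rewrite E eqxx mul1n muln1; congr (_ * f (upd _ _ _)).
    rewrite /bracket_index /bshift /shift_mono /= E; congr pair; apply/mnmP => t.
    rewrite mnmBE mnmDE mulmnE mnm1E mnmE [l == t]eq_sym.
    by case: (t =P l) => [->|_] /=; lia.
  by rewrite (negPf ne) mul0n muln0 !mul0r.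
apply: (int_comb_sumT (F := fun q f => (w q)%:~R * f (upd b q (bshift i 0 (b q))))) => q _.
apply: int_comb_point => [_|]; last by rewrite /w /cut_exp; case: eqP => _; lia.
have le0 : (0 <= (b q).1 l + i)%N by [].
have := mdeg_shiftm le0; rewrite !addn0 => E.
have := vtupP _ _ vb q; rewrite /valid => vq.
rewrite /near vtup_upd //; last by rewrite /valid /= E; lia.
by have := wt_upd b q (bshift i 0 (b q)); rewrite /= E; lia.
Qed.

Lemma shift_derB k u v (f g : tupfun k) b : shift_der u v (fun b => f b - g b) b = shift_der u v f b - shift_der u v g b.
Proof. by rewrite -sumrB; apply: eq_bigr => q _; rewrite mulrBr. Qed.

Fixpoint word N : ('I_N -> nat * nat) -> forall k, tupfun k -> tupfun k :=
  match N with
  | 0 => fun _ _ f => f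
  | N'.+1 => fun p _ f => shift_der (p ord0).1 (p ord0).2 (word (p \o lift ord0) f)
  end.

Lemma wordS N (p : 'I_N.+1 -> nat * nat) k (f : tupfun k) :
  word p f = shift_der (p ord0).1 (p ord0).2 (word (p \o lift ord0) f).
Proof. by []. Qed.

Definition pshift N (p : 'I_N -> nat * nat) : int := \sum_r ((p r).1%:Z - (p r).2%:Z).

Lemma pshiftS N (p : 'I_N.+1 -> nat * nat) :
  pshift p = (p ord0).1%:Z - (p ord0).2%:Z + pshift (p \o lift ord0).
Proof. by rewrite /pshift big_ord_recl. Qed.

Lemma word_growth N (p : 'I_N -> nat * nat) k : (forall r, (p r).2 + d <= M)%N ->
  growth N (pshift p) (@word N p k).
Proof.
elim: N p => [|N IHN] p leM.
  exists 1%N => b vb; apply: (int_comb_ext (F := fun f => 1%:~R * f b)) => [f|].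
    by rewrite mul1r.
  by apply: int_comb_point => // _; rewrite /near vb /pshift big_ord0 addr0 /=.
have O1 := shift_der_growth K l k (p ord0).1 (leM ord0).
have O2 := IHN (p \o lift ord0) (fun r => leM (lift ord0 r)).
by rewrite pshiftS; apply: growth_leq (growth_comp O1 O2).
Qed.

Lemma wordB N (p : 'I_N -> nat * nat) k (f g : tupfun k) b :
  word p (fun b => f b - g b) b = word p f b - word p g b.
Proof.
elim: N p b => [//|N IHN] p b /=.
by rewrite -shift_derB; apply: eq_bigr => q _; rewrite IHN.
Qed.

(** Each product has order N + 1; the commutator passes through one letter at a time, losing one
    order there. *)
Lemma tuple_diff_word N (p : 'I_N -> nat * nat) k : (forall r, (p r).2 + d < M)%N ->
  growth N (pshift p) (fun (f : tupfun k) b => tuple_diff (word p f) b - word p (tuple_diff f) b).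
Proof.
elim: N p => [|N IHN] p leM.
  by apply: growth_ext (growth_0 _ _ _ _ _ _ _) => f b _ /=; rewrite subrr.
have ltM r : (((p \o lift ord0) r).2 + d < M)%N by exact: leM.
rewrite pshiftS; apply: (@growth_leq _ _ _ _ _ (1 + N)) => //.
have O1 := growth_comp (tuple_diff_shift_growth K l k (p ord0).1 (leM ord0)) (word_growth k (fun r => ltnW (ltM r))).
have O2 := growth_comp (shift_der_growth K l k.+1 (p ord0).1 (ltnW (leM ord0))) (IHN _ ltM).
apply: growth_ext (growth_D O1 O2) => f b _ /=.
by rewrite shift_derB addrA subrK.
Qed.

Lemma word_last N (p : 'I_N.+1 -> nat * nat) k (f : tupfun k) :
  word p f = word (p \o lift ord_max) (shift_der (p ord_max).1 (p ord_max).2 f).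
Proof.
elim: N p => [|N IHN] p; first by rewrite /= (_ : ord0 = ord_max) //; apply: val_inj.
have max0 : lift ord0 ord_max = ord_max :> 'I_N.+2 by apply: val_inj.
rewrite wordS IHN [RHS]wordS /comp max0.
have -> : lift ord_max ord0 = ord0 :> 'I_N.+2 by apply: val_inj.
congr (shift_der _ _ (word _ _)); apply/funext => r.
by rewrite -max0 lift_lift0.
Qed.

Lemma word_diag N (p : 'I_N -> nat * nat) k (f : tupfun k) b :
  (forall r, (p r).1 = (p r).2) -> word p f b = (\sum_q cut (b q))%:R ^+ N * f b.
Proof.
elim: N p => [|N IHN] p pE; first by rewrite mul1r.
rewrite /= /shift_der natr_sum exprS -mulrA mulr_suml; apply: eq_bigr => q _.
have -> : bshift (p ord0).1 (p ord0).2 (b q) = b q.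
  rewrite /bshift /shift_mono pE [RHS]surjective_pairing; congr pair; apply/mnmP => t.
  by rewrite mnmE; case: eqP => // _; lia.
by rewrite upd_id IHN ?natr_sum // => r; exact: pE.
Qed.

(* The leading part of a word: all the coefficients are evaluated at b.       *)
Definition cshift N (p : 'I_N -> nat * nat) k (phi : 'I_N -> 'I_k) (b : tup k) : tup k :=
  fun q => bshift (\sum_(r | phi r == q) (p r).1) (\sum_(r | phi r == q) (p r).2) (b q).

Definition leading N (p : 'I_N -> nat * nat) k (f : tupfun k) : tupfun k := fun b =>
  \sum_(phi : {ffun 'I_N -> 'I_k}) (\prod_r cut (b (phi r)))%:R * f (cshift p phi b).

(** To leading order the letters commute, which allows any chosen letter to be moved to the end of a
    word. *)
Lemma leading_perm N (p : 'I_N -> nat * nat) k (f : tupfun k) b (s : 'S_N) :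
  leading (p \o s) f b = leading p f b.
Proof.
rewrite /leading (reindex_inj (h := fun phi : {ffun 'I_N -> 'I_k} => [ffun r => phi (s r)])) /=.
  apply: eq_bigr => phi _; congr (_%:R * f _).
    rewrite [RHS](reindex_inj (@perm_inj _ s)); apply: eq_bigr => r _.
    by rewrite ffunE.
  apply/funext => q; congr bshift; rewrite [RHS](reindex_inj (@perm_inj _ s));
    by apply: eq_bigl => r; rewrite ffunE.
move=> phi psi /ffunP E; apply/ffunP => r; have := E (s^-1 r)%g.
by rewrite !ffunE permKV.
Qed.

(* Vanishing of a minor of size N > k of the rank k matrix with entries       *)
(* sum_q a_q s_q^(u r - v r'), where s_q shifts the q-th exponent a_q: some   *)
(* two rows are attached to the same q, and swapping them changes the sign.   *)
Lemma leading_alternate N (u v : 'I_N -> nat) k (f : tupfun k) b :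
  [pchar K] =i pred0 -> (k < N)%N ->
  \sum_(s : 'S_N) (-1) ^+ s * leading (fun r => (u r, v (s r))) f b = 0.
Proof.
move=> charK0 ltkN; rewrite /leading; under eq_bigr do rewrite mulr_sumr.
rewrite exchange_big big1 //= => phi _.
have [r1 [r2 [r12 phi12]]] : exists r1 r2, r1 != r2 /\ phi r1 = phi r2.
  have /injectivePn[r1 [r2 r12 E]] : ~~ injectiveb phi.
    apply/injectiveP => /leq_card; rewrite !card_ord; lia.
  by exists r1, r2.
pose t := tperm r1 r2; apply: (@mulrnI_char0 _ charK0 2) => //=.
rewrite mul0rn mulr2n {2}(reindex_inj (mulgI t)) /= -big_split big1 // => s _ /=.
rewrite odd_permM odd_tperm r12 signr_addb expr1 mulN1r mulNr.
apply/eqP; rewrite subr_eq0; apply/eqP; congr (_ * (_ * f _)).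
apply/funext => q; congr bshift => /=.
rewrite (reindex_inj (@perm_inj _ t)) /=; apply: eq_big => [r|r _].
  by congr (_ == q); rewrite /t; case: tpermP => // ->.
by rewrite permM.
Qed.

End Words.

(** * Comparison of a word with its leading part *)

Section LeadingParts.
Variables (K : fieldType) (n d : nat) (l : 'I_n) (M : nat).
Local Notation mono_index := (mono_index n).
Local Notation tup k := (tup n k).
Local Notation tupfun k := (tupfun K n k).
Local Notation growth := (@growth K n d _ _).
Local Notation vtup := (@vtup n d _).
Local Notation cut := (cut_exp l M).
Local Notation bshift := (@bshift n l).
Local Notation word := (@word K n l M _).
Local Notation csh := (@cshift n l _).
Implicit Types (x y z : mono_index).

(* The coefficient and the end point of the path of a word in which the r-th  *)
(* letter acts on the argument phi r.                                         *)
Fixpoint path_coef N : ('I_N -> nat * nat) -> forall k, ('I_N -> 'I_k) -> tup k -> nat :=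
  match N with
  | 0 => fun _ _ _ _ => 1%N
  | N'.+1 => fun p _ phi b => (cut (b (phi ord0)) *
      path_coef (p \o lift ord0) (phi \o lift ord0)
        (upd b (phi ord0) (bshift (p ord0).1 (p ord0).2 (b (phi ord0)))))%N
  end.

Fixpoint path_end N : ('I_N -> nat * nat) -> forall k, ('I_N -> 'I_k) -> tup k -> tup k :=
  match N with
  | 0 => fun _ _ _ b => b
  | N'.+1 => fun p _ phi b => path_end (p \o lift ord0) (phi \o lift ord0)
        (upd b (phi ord0) (bshift (p ord0).1 (p ord0).2 (b (phi ord0))))
  end.

Lemma word_paths N (p : 'I_N -> nat * nat) k (f : tupfun k) b :
  word p f b = \sum_(phi : {ffun 'I_N -> 'I_k}) (path_coef p phi b)%:R * f (path_end p phi b).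
Proof.
elim: N p b => [|N IHN] p b.
  rewrite /= (big_pred1 [ffun r : 'I_0 => match r with Ordinal m lm => False_rect 'I_k (notF lm) end]) ?mul1r // => phi.
  by rewrite /=; apply/esym/eqP/ffunP => -[].
rewrite sum_ffun_cons wordS /shift_der; apply: eq_bigr => q _.
rewrite IHN mulr_sumr; apply: eq_bigr => psi _.
have E0 : [ffun r => consf q psi r] ord0 = q by rewrite ffunE consf0.
have ES : [ffun r => consf q psi r] \o lift ord0 = psi.
  by apply/funext => r /=; rewrite ffunE consfS.
by rewrite /= E0 ES natrM mulrA.
Qed.

Lemma path_end_step N (p : 'I_N.+1 -> nat * nat) k (phi : 'I_N.+1 -> 'I_k) (b : tup k) :
  let b' := upd b (phi ord0) (bshift (p ord0).1 (p ord0).2 (b (phi ord0))) in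
  vtup b -> ((p ord0).2 + d < (b (phi ord0)).1 l)%N ->
  (vtup b' -> path_end (p \o lift ord0) (phi \o lift ord0) b' =
     csh (p \o lift ord0) (phi \o lift ord0) b' /\
   near d b' (pshift (p \o lift ord0)) (path_end (p \o lift ord0) (phi \o lift ord0) b')) ->
  path_end p phi b = csh p phi b /\ near d b (pshift p) (path_end p phi b).
Proof.
move=> b' vb lt_b IH; have /andP[vb' /eqP wb'] := near_shift (p ord0).1 vb lt_b.
have [E /andP[ve /eqP we]] := IH vb'; split; last first.
  rewrite /near -[path_end p phi b]/(path_end (p \o lift ord0) (phi \o lift ord0) b').
  by rewrite ve we wb' pshiftS -!addrA /=.
rewrite /= -/b' E; apply/funext => q; rewrite /cshift.
have sumE (g : 'I_N.+1 -> nat) : (\sum_(r | phi r == q) g r =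
    (if phi ord0 == q then g ord0 else 0) +
    \sum_(r | (phi \o lift ord0) r == q) (g \o lift ord0) r)%N.
  by rewrite big_mkcond big_ord_recl -big_mkcond.
have /= E1 := sumE (fun r => (p r).1); have /= E2 := sumE (fun r => (p r).2).
rewrite /cshift E1 E2 /b' /upd eq_sym; case: eqP => [qE|//]; rewrite ?qE in lt_b *.
congr pair; apply/mnmP => i; rewrite !mnmE /=; case: (i =P l) => [->|//]; lia.
Qed.

Lemma path_end_coef N (p : 'I_N -> nat * nat) k (phi : 'I_N -> 'I_k) (b : tup k) :
  vtup b -> (forall r, (p r).2 + d <= M)%N -> path_coef p phi b != 0%N ->
  path_end p phi b = csh p phi b /\ near d b (pshift p) (path_end p phi b).
Proof.
elim: N p phi b => [|N IHN] p phi b vb leM.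
  move=> _; split; last by rewrite /near vb /pshift big_ord0 addr0 /=.
  apply/funext => q; rewrite /cshift !big_ord0 [LHS]surjective_pairing; congr pair.
  by apply/mnmP => i; rewrite mnmE /=; case: eqP => // _; lia.
rewrite /= muln_eq0 negb_or => /andP[c0 cS]; apply: path_end_step => // [|vb'].
  by move: c0 (leM ord0); rewrite /cut_exp; lia.
by apply: IHN => // r; apply: leM.
Qed.

(** Complements [path_end_coef]: the path may have coefficient 0 while its leading coefficient is
    nonzero, but then the exponents are too large for any truncation. *)
Lemma path_end_large N (p : 'I_N -> nat * nat) k (phi : 'I_N -> 'I_k) (b : tup k) :
  vtup b -> (forall r, \sum_r (p r).2 + d < (b (phi r)).1 l)%N ->
  path_end p phi b = csh p phi b /\ near d b (pshift p) (path_end p phi b).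
Proof.
elim: N p phi b => [|N IHN] p phi b vb lt_b.
  split; last by rewrite /near vb /pshift big_ord0 addr0 /=.
  apply/funext => q; rewrite /cshift !big_ord0 [LHS]surjective_pairing; congr pair.
  by apply/mnmP => i; rewrite mnmE /=; case: eqP => // _; lia.
move: lt_b; rewrite big_ord_recl => lt_b.
apply: path_end_step => // [|vb']; first by have := lt_b ord0; lia.
apply: IHN => // r /=; have := lt_b (lift ord0 r).
rewrite /upd; case: eqP => [->|_] /=; last by lia.
by rewrite mnmE eqxx; lia.
Qed.

(** [b0] is the tuple at which the leading coefficient is evaluated, [E] the deviation accumulated
    so far and [S] a bound on the shifts to come, so E + S is constant along the induction. Two
    products of N factors at most [W], differing factorwise by at most E + S, are compared by
    telescoping. *)
Lemma path_coef_bound N (p : 'I_N -> nat * nat) k (phi : 'I_N -> 'I_k) (b b0 : tup k) S E W :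
  (\sum_r ((p r).1 + (p r).2) <= S)%N ->
  (forall q, (b q).1 l <= (b0 q).1 l + E /\ (b0 q).1 l <= (b q).1 l + E)%N ->
  (forall q, (b q).1 l + S <= W /\ (b0 q).1 l <= W)%N ->
  (`|(path_coef p phi b)%:Z - (\prod_r cut (b0 (phi r)))%:Z| <= N * (E + S) * W ^ N.-1)%N.
Proof.
elim: N p phi b S E => [|N IHN] p phi b S E leS leE leW; first by rewrite big_ord0.
move: leS; rewrite big_ord_recl => leS.
set b' := upd b (phi ord0) (bshift (p ord0).1 (p ord0).2 (b (phi ord0))).
pose s0 := ((p ord0).1 + (p ord0).2)%N.
have b'E q : ((b' q).1 l <= (b q).1 l + (p ord0).1 /\ (b q).1 l <= (b' q).1 l + (p ord0).2)%N.
  by rewrite /b' /upd; case: eqP => [->|_] /=; rewrite ?mnmE ?eqxx; lia.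
have IH := IHN (p \o lift ord0) (phi \o lift ord0) b' (S - s0)%N (E + s0)%N.
rewrite (_ : (E + s0 + (S - s0) = E + S)%N) in IH; last by rewrite /s0; lia.
have /IH{}IH : (\sum_r (((p \o lift ord0) r).1 + ((p \o lift ord0) r).2) <= S - s0)%N.
  by move: leS; rewrite /s0 /=; lia.
have /IH{}IH : (forall q, (b' q).1 l <= (b0 q).1 l + (E + s0) /\ (b0 q).1 l <= (b' q).1 l + (E + s0))%N.
  by move=> q; have := b'E q; have := leE q; rewrite /s0; lia.
have /IH{}IH : (forall q, (b' q).1 l + (S - s0) <= W /\ (b0 q).1 l <= W)%N.
  by move=> q; have := b'E q; have := leW q; rewrite /s0; lia.
rewrite /= big_ord_recl -/b'.
set c := path_coef _ _ _ in IH *; set c0 := (\prod_r _)%N in IH *.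
have c0W : (c0 <= W ^ N)%N.
  rewrite -[N in (W ^ N)%N]card_ord -prod_nat_const; apply: leq_prod => r _.
  by rewrite /cut_exp /=; have := leW (phi (lift ord0 r)); lia.
set x := cut_exp _ _ _; set y := cut_exp _ _ _; set e := (_ - _ : int).
have eE : e = x%:Z * (c%:Z - c0%:Z) + (x%:Z - y%:Z) * c0%:Z.
  by rewrite /e !PoszM; ring.
have xW : (x <= W)%N by rewrite /x /cut_exp; have := leW (phi ord0); lia.
have xy : (`|x%:Z - y%:Z| <= E)%N.
  by rewrite /x /y /cut_exp; have := leE (phi ord0); lia.
have le1 : (`|(x%:Z * (c%:Z - c0%:Z))%R| <= N * (E + S) * W ^ N)%N.
  rewrite abszM absz_nat; apply: leq_trans (leq_mul xW IH) _.
  rewrite mulnCA leq_mul2l; case: (N) => [|N'] /=; first by [].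
  by rewrite expnS leqnn orbT.
have le2 : (`|((x%:Z - y%:Z) * c0%:Z)%R| <= (E + S) * W ^ N)%N.
  rewrite abszM absz_nat; apply: leq_trans (leq_mul xy c0W) _.
  by rewrite leq_mul2r leq_addr orbT.
rewrite eE -addn1 mulnDl mul1n mulnDl.
by apply: leq_trans (leq_add le1 le2); lia.
Qed.

(** A word has order N, and the earlier letters change the coefficients of the later ones only by
    bounded amounts, which saves one order. *)
Lemma word_leading N (p : 'I_N -> nat * nat) k :
  (\sum_r ((p r).1 + (p r).2) + d < M)%N ->
  growth N.-1 (pshift p) (fun (f : tupfun k) b => word p f b - leading l M p f b).
Proof.
set S := (\sum_r _)%N => leM; have leS r : ((p r).2 <= S)%N.
  by rewrite /S (bigD1 r) //=; lia.
have leM' r : ((p r).2 + d <= M)%N by have := leS r; lia.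
have leS2 : (\sum_r (p r).2 <= S)%N by apply: leq_sum => r _; exact: leq_addl.
exists (#|{ffun 'I_N -> 'I_k}| * (N * S * S.+1 ^ N.-1))%N => b vb.
pose w (phi : {ffun 'I_N -> 'I_k}) := (path_coef p phi b)%:Z - (\prod_r cut (b (phi r)))%:Z.
have wE phi : w phi != 0 ->
    path_end p phi b = csh p phi b /\ near d b (pshift p) (path_end p phi b).
  have [c0|c0 _] := eqVneq (path_coef p phi b) 0%N; last first.
    exact: path_end_coef.
  move=> w0; apply: path_end_large => // r.
  have chi0 : cut (b (phi r)) != 0%N.
    by apply: contraNneq w0 => chi0; rewrite /w c0 (bigD1 r) //= chi0 mul0n subrr.
  by move: chi0; rewrite /cut_exp; lia.
refine (int_comb_ext (F := fun f => \sum_phi (w phi)%:~R * f (path_end p phi b)) _ _).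
  move=> f; rewrite word_paths /leading -sumrB; apply: eq_bigr => phi _.
  have [w0|/wE[<- _]] := eqVneq (w phi) 0; last by rewrite rmorphB mulrBl.
  rewrite w0 mul0r; apply/esym/eqP; rewrite subr_eq0; apply/eqP.
  move/eqP: w0; rewrite subr_eq0 eqz_nat => /eqP cE.
  have [c0|c0] := eqVneq (path_coef p phi b) 0%N; first by rewrite -cE c0 !mul0r.
  by have [-> _] := path_end_coef vb leM' c0; rewrite cE.
rewrite -mulnA; apply: (int_comb_sumT (F := fun phi f => (w phi)%:~R * f (path_end p phi b))) => phi _.
apply: int_comb_point => [/wE[]//|].
apply: leq_trans (@path_coef_bound _ p _ phi b b S 0 (S.+1 * (wt b).+1) _ _ _) _ => //.
- by move=> q; rewrite addn0.
- by move=> q; have := coord_le_wt b q l; nia.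
- by rewrite add0n expnMn !mulnA.
Qed.

End LeadingParts.

(** * The vanishing minor and the homotopy to leading order *)

Section Homotopy.
Variables (K : fieldType) (charK0 : [pchar K] =i pred0) (n d k : nat).
Local Notation tup k := (tup n k).
Local Notation tupfun k := (tupfun K n k).
Local Notation growth := (@growth K n d _ _).
Local Notation vtup := (@vtup n d _).
Local Notation N := k.+2.
Local Notation m := d.+1.
Implicit Types (s : 'S_N).

(* Larger than any shift below, so that truncated shifts never occur with a   *)
(* nonzero coefficient.                                                       *)
Definition cutoff := (N * (2 * m * N) + d).+1.
Local Notation M := cutoff.

(* The word s stands for the term of s in the expansion of the minor of size  *)
(* k + 2 with entries shift_der (m * r) (m * r'). When s != 1 it has a letter *)
(* with s r < r, which agrees to leading order with the Lie derivative along  *)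
(* the element x_l^(m (r - s r) + 1) d/dx_l of L_d.                           *)
Definition letters (s : 'S_N) (r : 'I_N) : nat * nat := (m * r, m * s r)%N.
Definition descent (s : 'S_N) : 'I_N := odflt ord_max [pick r | s r < r]%N.
(** Brings the letter to be replaced to the last position, where it acts first, directly on the
    cochain. *)
Definition last_descent s : 'S_N := lift_perm ord_max (descent s) 1.
Definition init_letters s : 'I_k.+1 -> nat * nat := letters s \o last_descent s \o lift ord_max.
Definition last_gap s : nat := (m * (descent s - s (descent s)))%N.

Lemma descentP s : s != 1%g -> (s (descent s) < descent s)%N.
Proof.
move=> s1; rewrite /descent; case: pickP => //= s_ge.
have le_s (r : 'I_N) : (r <= s r)%N by rewrite leqNgt s_ge.
case/eqP: s1; apply/permP => r; rewrite perm1; apply: val_inj.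
(* A permutation preserves the sum of the indices, so r <= s r for all r forces equality. *)
have sumE : (\sum_(r : 'I_N) s r = \sum_(r : 'I_N) r)%N.
  by rewrite [RHS](reindex_inj (@perm_inj _ s)).
have := leqif_sum (fun (r : 'I_N) (_ : true) => leqif_eq (le_s r)).
by case=> _; rewrite sumE eqxx => /esym/forallP/(_ r)/eqP/esym.
Qed.

Lemma letters_sum s : (\sum_r ((letters s r).1 + (letters s r).2) + d < M)%N.
Proof.
rewrite /cutoff ltnS leq_add2r -[X in (_ <= X * _)%N](card_ord N) -sum_nat_const.
by apply: leq_sum => r _; rewrite /= -mulnA mul2n -addnn leq_add // leq_mul2l ltnW ?orbT.
Qed.

Lemma letters_lt s r : ((letters s r).2 + d < M)%N.
Proof. by have := letters_sum s; rewrite (bigD1 r) //=; lia. Qed.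

Lemma pshift_letters s : pshift (letters s) = 0.
Proof.
rewrite /pshift sumrB [X in X - _](reindex_inj (@perm_inj _ s)) /=.
by rewrite subrr.
Qed.

Lemma pshift_init s : s != 1%g -> pshift (init_letters s) + (last_gap s)%:Z = 0.
Proof.
move=> /descentP lt_s; rewrite -[RHS](pshift_letters s) /pshift.
rewrite [RHS](reindex_inj (@perm_inj _ (last_descent s))) [RHS](bigD1_ord ord_max) //=.
rewrite [LHS]addrC; congr (_ + _); rewrite /last_descent lift_perm_id /last_gap; lia.
Qed.

Definition contract i l k (f : tupfun k.+1) : tupfun k := fun b => f (consf (xpow l i) b).

Lemma contract_growth i l k' : (d <= i)%N -> growth 0 i%:Z (@contract i l k').
Proof.
move=> le_i; exists 1%N => b vb; apply: (int_comb_ext (F := fun f => 1%:~R * f (consf (xpow l i) b))) => [f|].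
  by rewrite mul1r.
have mdegE : mdeg (xpow l i).1 = i.+1 by rewrite mdegMn mdeg1 mul1n.
apply: int_comb_point => // _; rewrite /near vtup_consf //=; last by rewrite /valid mdegE.
by rewrite wt_consf mdegE; lia.
Qed.

(** For a cocycle the last two terms cancel by Cartan's formula, leaving the differential of a word
    applied to the contraction. In this form the growth is controlled for every [f]: a commutator,
    minus a word ending in a Lie derivative. *)
Definition defect l s (f : tupfun k.+1) : tupfun k.+1 := fun b =>
  tuple_diff (word l M (init_letters s) (contract (last_gap s) l f)) b
  - word l M (init_letters s) (tuple_diff (contract (last_gap s) l f)) b
  - word l M (init_letters s) (lie_der l (last_gap s) f) b.

Definition weight_power l (b : tup k.+1) : nat := (\sum_q cut_exp l M (b q)) ^ N.

(** Replacing the Lie derivative by a shift, and the resulting words by their leading parts, costs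
    order k + 1. The leading parts for s != 1 add up, by the vanishing minor, to minus that of the
    identity, whose word is multiplication by [weight_power]. *)
Lemma defect_growth l : growth k.+1 0 (fun f b =>
  \sum_(s : 'S_N | s != 1%g) (-1) ^+ s * defect l s f b - (weight_power l b)%:R * f b).
Proof.
pose wl s (f : tupfun k.+1) b := word l M (letters s \o last_descent s) f b - leading l M (letters s) f b.
pose w1 (f : tupfun k.+1) b := word l M (letters 1%g) f b - leading l M (letters 1%g) f b.
pose X s (f : tupfun k.+1) b := tuple_diff (word l M (init_letters s) (contract (last_gap s) l f)) b
  - word l M (init_letters s) (tuple_diff (contract (last_gap s) l f)) b.
pose Y s (f : tupfun k.+1) b := word l M (init_letters s) (fun b => lie_der l (last_gap s) f b - shift_der l M (last_gap s) 0 f b) b.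
have ltp s r : ((init_letters s r).2 + d < M)%N by exact: letters_lt.
have oX s : s != 1%g -> growth k.+1 0 (X s).
  move=> s1; rewrite -(pshift_init s1).
  have le_d : (d <= last_gap s)%N by have := descentP s1; rewrite /last_gap; nia.
  have := growth_comp (tuple_diff_word K l k (ltp s)) (contract_growth l k le_d).
  by rewrite addn0.
have oY s : s != 1%g -> growth k.+1 0 (Y s).
  move=> s1; rewrite -(pshift_init s1).
  have := growth_comp (word_growth K l k.+1 (fun r => ltnW (ltp s r))) (lie_der_growth K d l M (last_gap s) k.+1).
  by rewrite addn0.
have owl s : growth k.+1 0 (wl s).
  have leM : (\sum_r (((letters s \o last_descent s) r).1 + ((letters s \o last_descent s) r).2) + d < M)%N.
    have := letters_sum s; rewrite (reindex_inj (@perm_inj _ (last_descent s))) /=; exact.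
  have := @word_leading K n d l M N _ k.+1 leM.
  rewrite (_ : pshift _ = 0); last first.
    by rewrite -[RHS](pshift_letters s) /pshift [RHS](reindex_inj (@perm_inj _ (last_descent s))).
  by apply: growth_ext => f b _; rewrite leading_perm.
have ow1 : growth k.+1 0 w1.
  by have := @word_leading K n d l M N _ k.+1 (letters_sum 1); rewrite pshift_letters.
have oS (Z : 'S_N -> tupfun k.+1 -> tupfun k.+1) : (forall s, s != 1%g -> growth k.+1 0 (Z s)) ->
    growth k.+1 0 (fun f b => \sum_(s : 'S_N | s != 1%g) (-1) ^+ s * Z s f b).
  by move=> oZ; apply: growth_sum => s s1; apply: growth_sign; apply: oZ.
apply: growth_ext (growth_B (growth_B (growth_B (oS _ oX) (oS _ oY)) (oS _ (fun s _ => owl s))) ow1) => f b vb.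
have alt0 := leading_alternate l M (fun r => m * r)%N (fun r => m * r)%N f b charK0 (ltnSn k.+1).
rewrite (bigD1 1%g) //= odd_perm1 mul1r in alt0.
have wE s : s != 1%g -> word l M (letters s \o last_descent s) f b = word l M (init_letters s) (shift_der l M (last_gap s) 0 f) b.
  move=> s1; rewrite word_last /comp /last_descent lift_perm_id.
  congr (word _ _ _ _ b); apply/funext => b'; rewrite shift_der_up /=; first by rewrite -mulnBr.
  by rewrite leq_mul2l ltnW ?descentP ?orbT.
have -> : (weight_power l b)%:R * f b = word l M (letters 1%g) f b.
  by rewrite word_diag ?natrX // => r; rewrite /letters perm1.
have lead1 : leading l M (letters 1%g) f b = - \sum_(s : 'S_N | s != 1%g) (-1) ^+ s * leading l M (letters s) f b.
  by apply/eqP; rewrite -addr_eq0; apply/eqP; rewrite -[RHS]alt0.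
rewrite /w1 lead1 opprK opprD addrA [LHS]addrAC; congr (_ - _).
rewrite -!sumrB; apply: eq_bigr => s s1 /=.
have telescope (x y z t : K) : x - (y - z) - (z - t) - t = x - y by ring.
by rewrite /X /Y /wl /defect wordB wE // -!mulrBr telescope.
Qed.

End Homotopy.

(** * Operations on continuous cochains *)

Section CochainOperations.
Variables (K : fieldType) (charK0 : [pchar K] =i pred0) (n d : nat).
Local Notation L := (Ld K n d).
Local Notation cochain := (cochain L).
Local Notation br := (@Ld_bracket K n d).
Local Notation vtup := (@vtup n d _).
Local Notation xm := (xmono K d).

Definition coefs k (c : cochain k) : tupfun K n k := fun b => c (xm \o b).

Lemma continuous_diff k (c : cochain k) :
  continuous_cochain c -> continuous_cochain (Ld_diff c).
Proof.
move=> [lc sc [m dm c0]]; split.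
- exact: (ce_diff_multilinear charK0 (@Ld_bracketC _ _ _) (@Ld_bracketDl _ _ _)).
- exact: (ce_diff_skew charK0 (@Ld_bracketC _ _ _)).
exists m => //; case: k c {lc sc} c0 => [//|k] c c0 x t xt.
rewrite /Ld_diff /ce_diff big1 // => j _; rewrite big1 // => i _.
case: (unliftP j t) xt => [t'|] -> xt; last first.
  rewrite (c0 _ ord0) ?mulr0 // cons_argE consf0 Ld_bracketC.
  have -> : - br (x j) (x (lift j i)) = (-1) *: br (x j) (x (lift j i)) + 0.
    by rewrite scaleN1r addr0.
  apply/asboolP => p a lt_a; rewrite Ld_valZD; move: (Ld_bracket_order (x (lift j i)) xt) => /asboolP -> //.
  by rewrite mulr0 add0r.
case: (unliftP i t') xt => [t''|] -> xt.
  by rewrite (c0 _ (lift ord0 t'')) ?mulr0 // cons_argE consfS.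
by rewrite (c0 _ ord0) ?mulr0 // cons_argE consf0; exact: Ld_bracket_order.
Qed.

Lemma coefs_diff k (c : cochain k) b : multilinear c -> vtup b ->
  coefs (Ld_diff c) b = tuple_diff (coefs c) b.
Proof.
case: k c b => [//|k] c b lc /vtupP vb.
rewrite /coefs /Ld_diff /ce_diff /tuple_diff; apply: eq_bigr => j _; apply: eq_bigr => i _.
congr (_ * _); rewrite cons_argE /= Ld_bracket_mono // mlin_consfB // !mlin_consfZ //.
rewrite /bracket_term /coefs !map_consf /bracket_index [(_ + (b j).1)%MM]addmC.
by congr (_ * c (consf (xm _) _) - _ * c (consf (xm _) _)); rewrite addmC.
Qed.

Section Shift.
Variables (l : 'I_n) (M u v : nat).

Definition shift_cochain k (c : cochain k) : cochain k := fun x =>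
  \sum_q c (upd x q (Ld_shift l M u v (x q))).

Lemma shift_cochain_continuous k (c : cochain k) : continuous_cochain c -> continuous_cochain (shift_cochain c).
Proof.
move=> [lc sc [m dm c0]]; split.
- move=> x i e y z; rewrite /shift_cochain mulr_sumr -big_split; apply: eq_bigr => q _ /=.
  change (c (upd (upd x i (e *: y + z)) q (Ld_shift l M u v (upd x i (e *: y + z) q))) =
    e * c (upd (upd x i y) q (Ld_shift l M u v (upd x i y q))) +
    c (upd (upd x i z) q (Ld_shift l M u v (upd x i z q)))).
  have [->|qi] := eqVneq q i; first by rewrite !upd_same !upd_upd Ld_shiftD mlinD.
  have iq : i != q by rewrite eq_sym.
  have E w : upd x i w q = x q by rewrite /upd (negPf qi).
  by rewrite !E !(updC _ _ _ iq) mlinD.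
- move=> x s; rewrite /shift_cochain mulr_sumr [RHS](reindex_inj (@perm_inj _ s)); apply: eq_bigr => q _ /=.
  rewrite -sc; congr c; symmetry; exact: (upd_inj x q _ (@perm_inj _ s)).
exists (m + v)%N => [|x i xi]; first by rewrite (leq_trans dm) ?leq_addr.
rewrite /shift_cochain big1 // => q _; apply: (c0 _ i); rewrite /upd; case: eqP => [<-|_].
  exact: Ld_shift_order.
by apply/asboolP => p a lt_a; move/asboolP: xi; apply; rewrite (leq_trans lt_a) // ltnS leq_addr.
Qed.

(** Holds at invalid tuples too, as d <= M makes [cut_exp] vanish on an invalid entry. *)
Lemma coefs_shift_cochain k (c : cochain k) b : (v <= M)%N -> (d <= M)%N -> multilinear c ->
  coefs (shift_cochain c) b = shift_der l M u v (coefs c) b.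
Proof.
move=> vM dM lc; apply: eq_bigr => q _; rewrite /coefs /=.
have -> : Ld_shift l M u v (xm (b q)) = (cut_exp l M (b q))%:R *: xm (bshift l u v (b q)).
  have [vq|nvq] := boolP (valid d (b q)); first exact: Ld_shift_mono.
  have -> : cut_exp l M (b q) = 0%N.
    apply/eqP; rewrite subn_eq0; apply: leq_trans dM; rewrite leqNgt.
    by apply: contra nvq => lt_d; rewrite /valid (leq_trans lt_d) // mdegE (bigD1 l) //= leq_addr.
  rewrite xmono_invalid // scale0r; have := Ld_shiftD l M u v (-1) (0 : L) 0.
  by rewrite scaler0 addr0 scaleN1r addNr.
by rewrite mlinZ // map_upd.
Qed.

End Shift.

Definition contract_cochain (e : mono_index n) k (c : cochain k.+1) : cochain k := fun x => c (consf (xm e) x).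

Lemma contract_cochain_continuous e k (c : cochain k.+1) :
  continuous_cochain c -> continuous_cochain (contract_cochain e c).
Proof.
move=> [lc sc [m dm c0]]; split.
- move=> x i a y z; change (c (consf (xm e) (upd x i (a *: y + z))) =
    a * c (consf (xm e) (upd x i y)) + c (consf (xm e) (upd x i z))).
  by rewrite -!upd_consfS mlinD.
- move=> x s; rewrite /contract_cochain; have := sc (consf (xm e) x) (lift_perm ord0 ord0 s).
  rewrite sign_lift_perm mul1r => <-; congr c; apply/funext => p /=.
  by case: (unliftP ord0 p) => [q|] ->; rewrite ?lift_perm_lift ?lift_perm_id ?consfS ?consf0.
by exists m => // x i xi; apply: (c0 _ (lift ord0 i)); rewrite consfS.
Qed.

Lemma coefs_contract_cochain e k (c : cochain k.+1) b : coefs (contract_cochain e c) b = coefs c (consf e b).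
Proof. by rewrite /coefs /contract_cochain map_consf. Qed.

Fixpoint word_cochain l M N : ('I_N -> nat * nat) -> forall k, cochain k -> cochain k :=
  match N with
  | 0 => fun _ _ c => c
  | N'.+1 => fun p _ c => shift_cochain l M (p ord0).1 (p ord0).2 (word_cochain l M (p \o lift ord0) c)
  end.

Lemma word_cochain_continuous l M N (p : 'I_N -> nat * nat) k (c : cochain k) :
  continuous_cochain c -> continuous_cochain (word_cochain l M p c).
Proof. by move=> cc; elim: N p => [//|N IHN] p; apply: shift_cochain_continuous; apply: IHN. Qed.

Lemma coefs_word_cochain l M N (p : 'I_N -> nat * nat) k (c : cochain k) :
  (forall r, (p r).2 + d < M)%N -> continuous_cochain c ->
  coefs (word_cochain l M p c) = word l M p (coefs c).
Proof.
move=> ltM cc; elim: N p ltM => [//|N IHN] p ltM; apply/funext => b.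
have [lw _ _] := word_cochain_continuous l M (p \o lift ord0) cc.
have := ltM ord0 => lt0; rewrite [LHS]coefs_shift_cochain //; try lia.
by rewrite IHN // => r; apply: ltM.
Qed.

Lemma sum_continuous k I (r : seq I) (P : pred I) (F : I -> cochain k) :
  (forall i, P i -> continuous_cochain (F i)) -> continuous_cochain (\sum_(i <- r | P i) F i).
Proof.
move=> cF; elim/big_rec: _ => [|i c Pi cc]; first exact: continuous_cochain0.
by rewrite -[F i]scale1r; apply: continuous_cochainZD => //; exact: cF.
Qed.

Lemma scale_continuous k (a : K) (c : cochain k) :
  continuous_cochain c -> continuous_cochain (a *: c).
Proof.
by move=> cc; rewrite -[_ *: _]addr0; apply: continuous_cochainZD => //; exact: continuous_cochain0.
Qed.

Lemma Ld_diff_sum k I (r : seq I) (P : pred I) (F : I -> cochain k) :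
  Ld_diff (\sum_(i <- r | P i) F i) = \sum_(i <- r | P i) Ld_diff (F i).
Proof.
elim/big_rec2: _ => [|i c1 c2 Pi <-]; first exact: Ld_diff0.
by rewrite -[F i]scale1r Ld_diffZD !scale1r.
Qed.

Lemma Ld_diffZ k (a : K) (c : cochain k) : Ld_diff (a *: c) = a *: Ld_diff c.
Proof. by rewrite -[_ *: c]addr0 Ld_diffZD Ld_diff0 addr0. Qed.

Lemma cochain_sumE k I (r : seq I) (P : pred I) (F : I -> cochain k) x :
  (\sum_(i <- r | P i) F i) x = \sum_(i <- r | P i) F i x.
Proof. by elim/big_rec2: _ => // i c1 c2 _ <-. Qed.

Lemma xmono_order m (a : mono_index n) : (m < mdeg a.1)%N -> Ld_val (xm a) \in vf_order m.
Proof.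
move=> lt_a; apply/asboolP => i p lt_p /=; case: ifP => // _.
by case: (p =P a.1) => [E|_]; rewrite ?andbF //; move: lt_a; rewrite -E ltnNge -ltnS lt_p.
Qed.

(** Continuity lets each argument be replaced by a polynomial truncation, which multilinearity
    expands into monomials. The induction is on the number of leading arguments still arbitrary. *)
Lemma coefs_eq0 k (c : cochain k) : continuous_cochain c ->
  (forall b, vtup b -> coefs c b = 0) -> c = 0.
Proof.
move=> [lc _ [m _ c0]] vc.
have vc' b : coefs c b = 0.
  have [vb|/forallPn[q nv]] := boolP (vtup b); first exact: vc.
  by rewrite /coefs -(upd_id (xm \o b) q) /= xmono_invalid // mlin0.
suff H j : forall x : 'I_k -> L, (forall i : 'I_k, (j <= i)%N -> exists a, x i = xm a) -> c x = 0.
  by apply/funext => x; apply: (H k) => i; rewrite leqNgt ltn_ord.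
elim: j => [|j IHj] x mono_x.
  have /fin_all_exists[b xb] : forall i, exists a, x i = xm a by move=> i; apply: mono_x.
  by rewrite (_ : x = xm \o b) ?[LHS]vc' //; apply/funext => i; rewrite xb.
have [lt_j|le_k] := ltnP j k; last first.
  by apply: IHj => i le_i; have := ltn_ord i; rewrite ltnNge (leq_trans le_k le_i).
pose i0 := Ordinal lt_j; pose y := x i0.
(* Degrees up to [m] are kept, so that the remainder lies in [vf_order m], where [c] vanishes. *)
pose trunc : L := \sum_(p : 'X_{1..n < m.+1} * 'I_n) Ld_val y p.2 (bmnm p.1) *: xm (bmnm p.1, p.2).
have truncE i a : (mdeg a < m.+1)%N -> Ld_val trunc i a = Ld_val y i a.
  move=> lt_a; have sumE (s : seq ('X_{1..n < m.+1} * 'I_n)) F :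
      Ld_val (\sum_(p <- s) F p : L) i a = \sum_(p <- s) Ld_val (F p) i a.
    by elim/big_rec2: _ => // p y1 y2 _ <-.
  have scaleE e z : Ld_val (e *: z : L) i a = e * Ld_val z i a by [].
  have monoE t : Ld_val (xm t) i a = if (mdeg a < d.+1)%N then 0 else ((i == t.2) && (a == t.1))%:R.
    by [].
  rewrite sumE (bigD1 (BMultinom lt_a, i)) // big1 ?addr0 => [|[p i'] /andP[_ /eqP ne]].
    rewrite scaleE monoE; case: ifP => [lt_d|_]; last by rewrite /= !eqxx mulr1 addr0.
    by rewrite mulr0 /= addr0; have /asboolP-> := Ld_valP y.
  rewrite scaleE monoE; case: ifP => _; rewrite ?mulr0 //.
  case: (i =P _) => [Ei|_]; rewrite ?mulr0 //; case: (a =P _) => [Ea|_]; rewrite ?mulr0 //.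
  case: ne; congr pair; last by rewrite Ei.
  by apply: val_inj; rewrite /= Ea.
have rest_order : Ld_val (y - trunc) \in vf_order m.
  apply/asboolP => i a lt_a; rewrite -[LHS]/(Ld_val y i a - Ld_val trunc i a).
  by rewrite truncE // subrr.
have -> : x = upd x i0 (1 *: trunc + (y - trunc)).
  by rewrite scale1r addrC subrK upd_id.
rewrite mlinD // mul1r (c0 (upd x i0 (y - trunc)) i0) ?upd_same // addr0.
rewrite mlin_sum // big1 // => p _; rewrite mlinZ // IHj ?mulr0 // => i le_i.
rewrite /upd; case: eqP => [_|ne]; first by exists (bmnm p.1, p.2).
apply: mono_x; rewrite ltn_neqAle le_i andbT; apply/eqP => E.
by case: ne; apply: val_inj.
Qed.

Lemma Ld_diffK k (c : cochain k) : continuous_cochain c -> Ld_diff (Ld_diff c) = 0.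
Proof.
move=> cc; apply: coefs_eq0 => [|b /vtupP vb]; first by do 2!apply: continuous_diff.
have [lc sc _] := cc.
apply: (ce_diffK charK0 (@Ld_bracketC _ _ _) (@Ld_bracketDl _ _ _)) => // i j t.
exact: Ld_jacobi_mono.
Qed.

End CochainOperations.

(** * Reduction to bounded weight *)

(** Rows are given as lists that may repeat an index or meet the diagonal. Collecting equal indices
    only decreases absolute values, and the part on the diagonal is absorbed in the strict
    inequality. *)
Lemma dominant_orbit (K : fieldType) (charK0 : [pchar K] =i pred0)
    (I : finType) (D : I -> nat) (s : I -> seq (int * I)) (x : nat -> I -> K) :
  (forall i, \sum_(p <- s i) `|p.1|%N < D i)%N ->
  (forall t i, x t.+1 i = (D i)%:R * x t i + \sum_(p <- s i) p.1%:~R * x t p.2) ->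
  exists T, exists q : nat -> K,
    forall i, x 0%N i = \sum_(t < T) q t * x t.+1 i.
Proof.
move=> dom xS; pose E i j := \sum_(p <- s i | p.2 == j) p.1.
apply: (@diag_dominant_orbit _ charK0 _ (fun i j => (D i * (i == j))%:Z + E i j)) => [i|t i].
  rewrite eqxx muln1.
  have leE j : `|E i j| <= \sum_(p <- s i | p.2 == j) `|p.1| by exact: ler_norm_sum.
  have sumE : \sum_j \sum_(p <- s i | p.2 == j) `|p.1| = \sum_(p <- s i) `|p.1|.
    rewrite (exchange_big_dep xpredT) //=; apply: eq_bigr => p _.
    by rewrite (big_pred1 p.2) // => j; rewrite eq_sym.
  have ltD : \sum_(p <- s i) `|p.1| < (D i)%:Z.
    by have := dom i; rewrite -ltz_nat -natz natr_sum; under eq_bigr do rewrite natz abszE.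
  rewrite (eq_bigr (fun j => `|E i j|)) => [|j /negPf ji]; last first.
    by rewrite eq_sym ji muln0 add0r.
  have le1 : `|E i i| + \sum_(j | j != i) `|E i j| <= \sum_(p <- s i) `|p.1|.
    rewrite -sumE [leRHS](bigD1 i) //= lerD //; exact: ler_sum.
  apply: lt_le_trans (lerB_normD _ _); rewrite ltrBrDl.
  exact: le_lt_trans le1 ltD.
rewrite xS; under [RHS]eq_bigr do rewrite rmorphD mulrDl.
rewrite big_split; congr (_ + _).
  rewrite (bigD1 i) //= eqxx muln1 big1 ?addr0 // => j /negPf ji.
  by rewrite eq_sym ji muln0 mul0r.
under [RHS]eq_bigr do rewrite rmorph_sum mulr_suml big_mkcond.
rewrite exchange_big; apply: eq_bigr => p _ /=.
rewrite (bigD1 p.2) //= eqxx big1 ?addr0 // => j /negPf jp.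
by rewrite eq_sym jp.
Qed.

Section CohomologyReduction.
Variables (K : fieldType) (charK0 : [pchar K] =i pred0) (n d k : nat).
Local Notation L := (Ld K n d).
Local Notation cochain := (cochain L).
Local Notation vtup := (@vtup n d _).
Local Notation M := (cutoff d k).

(* The minor vanishes to leading order, so its diagonal term, which           *)
(* multiplies by a power of the weight, is minus the sum of the other ones.   *)
(* In those the Lie derivative is replaced here by the contraction.           *)
Definition homotopy (c : cochain k.+1) : cochain k :=
  \sum_(l < n) \sum_(s : 'S_k.+2 | s != 1%g)
    (-1) ^+ s *: word_cochain l M (init_letters d s) (contract_cochain (xpow l (last_gap d s)) c).

Lemma homotopy_continuous c : continuous_cochain c -> continuous_cochain (homotopy c).
Proof.
move=> cc; apply: sum_continuous => l _; apply: sum_continuous => s _.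
by apply: scale_continuous; apply: word_cochain_continuous; apply: contract_cochain_continuous.
Qed.

Lemma coefs_diff_homotopy c b : continuous_cochain c -> Ld_diff c = 0 -> vtup b ->
  coefs (Ld_diff (homotopy c)) b =
  \sum_(l < n) \sum_(s : 'S_k.+2 | s != 1%g) (-1) ^+ s * defect d l s (coefs c) b.
Proof.
move=> cc dc vb; rewrite /coefs Ld_diff_sum cochain_sumE; apply: eq_bigr => l _.
rewrite Ld_diff_sum cochain_sumE; apply: eq_bigr => s s1.
rewrite Ld_diffZ -[LHS]/((-1) ^+ s * coefs (Ld_diff _) b); congr (_ * _).
set e := xpow l (last_gap d s).
have [lw _ _] := word_cochain_continuous l M (init_letters d s) (contract_cochain_continuous e cc).
have ltp r : ((init_letters d s r).2 + d < M)%N by exact: letters_lt.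
have iE : coefs (contract_cochain e c) = contract (last_gap d s) l (coefs c).
  by apply/funext => b'; rewrite coefs_contract_cochain.
rewrite coefs_diff // coefs_word_cochain //; last exact: contract_cochain_continuous.
rewrite iE /defect.
have ve : valid d e.
  rewrite /valid /e mdegMn mdeg1 mul1n.
  by have := descentP s1; rewrite /last_gap; nia.
have [lc sc _] := cc.
have [li _ _] := contract_cochain_continuous e cc.
have cartan b' : vtup b' -> tuple_diff (contract (last_gap d s) l (coefs c)) b' = - lie_der l (last_gap d s) (coefs c) b'.
  move=> vb'; rewrite -iE -coefs_diff //.
  rewrite [LHS](ce_diff_contract (xmono K d e) (xmono K d \o b') sc); last first.
    by move=> y; rewrite -[LHS]/(Ld_diff c y) dc.
  congr (- _); apply: eq_bigr => q _; rewrite Ld_bracket_mono //; last exact/(vtupP _ _ vb').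
  rewrite -[_ - _]addrC -scaleNr mlinD // mlinZ // mulNr addrC /coefs !map_upd /bracket_index.
  by rewrite [((b' q).1 + _)%MM]addmC.
have -> : word l M (init_letters d s) (tuple_diff (contract (last_gap d s) l (coefs c))) b =
    - word l M (init_letters d s) (lie_der l (last_gap d s) (coefs c)) b.
  pose th := lie_der l (last_gap d s) (coefs c).
  have -> : - word l M (init_letters d s) th b = word l M (init_letters d s) (fun b => th b - th b - th b) b.
    by rewrite !wordB subrr sub0r.
  apply: (growth_eq (word_growth K l k.+1 (fun r => ltnW (ltp r)))) => // b' vb'.
  by rewrite cartan // subrr sub0r.
by rewrite opprK addrK.
Qed.

Definition diagonal (b : tup n k.+1) : nat := (\sum_(l < n) weight_power d l b)%N.

(** Up to a constant, the weight is at most the sum over all directions of the cut exponents, so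
    some direction carries at least a fixed fraction of it, raised to the power k + 2 in [diagonal].
    This is why [homotopy] sums over l. *)
Lemma diagonal_large (n_ge1 : (0 < n)%N) C : exists W0, forall b : tup n k.+1,
  (W0 < wt b)%N -> (C * (wt b).+1 ^ k.+1 < diagonal b)%N.
Proof.
pose A := (n * (k.+1 * M))%N.
(* Beyond 2 * A the best direction satisfies 2 n S >= wt + 1; the other summand makes one more power
   of wt + 1 outweigh the constant [C]. *)
exists (2 * A + (2 * n) ^ k.+2 * C)%N => b lt_b.
pose S (l : 'I_n) := (\sum_q cut_exp l M (b q))%N.
have sumS : (wt b <= \sum_l S l + A)%N.
  rewrite /wt /S exchange_big /= /A -[X in (X * _)%N](card_ord n) -sum_nat_const.
  apply: (@leq_trans (\sum_(q < k.+1) (\sum_(l < n) cut_exp l M (b q) + n * M))%N).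
    apply: leq_sum => q _; rewrite mdegE -[X in (X * _)%N](card_ord n) -sum_nat_const -big_split /=.
    by apply: leq_trans (leq_pred _) _; apply: leq_sum => l _; rewrite /cut_exp; lia.
  by rewrite big_split /= leq_add2l !sum_nat_const !card_ord; apply: eq_leq; ring.
have [l leS] : exists l, (wt b <= n * S l + A)%N.
  apply: contrapT => /forallNP ltS.
  have : (\sum_(l < n) (n * S l + A).+1 <= \sum_(l < n) wt b)%N.
    by apply: leq_sum => l _; rewrite ltnNge; apply/negP; exact: ltS.
  under eq_bigr do rewrite -addnS.
  rewrite big_split /= -big_distrr /= !sum_nat_const !card_ord -mulnDr leq_mul2l.
  by rewrite (gtn_eqF n_ge1) /= addnS ltnNge sumS.
have le_S : (2 * n * S l >= (wt b).+1)%N by move: lt_b leS; rewrite -/A; lia.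
have leD : (S l ^ k.+2 <= diagonal b)%N by rewrite /diagonal (bigD1 l) //= leq_addr.
rewrite -(@ltn_pmul2l ((2 * n) ^ k.+2)) ?expn_gt0 ?muln_gt0 ?n_ge1 //.
apply: (@leq_trans ((2 * n) ^ k.+2 * S l ^ k.+2)%N); last by rewrite leq_mul2l leD orbT.
rewrite -expnMn; apply: (@leq_trans ((wt b).+1 ^ k.+2)%N); last by rewrite leq_exp2r.
rewrite mulnA [in X in (_ < X)%N]expnS ltn_pmul2r ?expn_gt0 //.
by rewrite ltnS; apply: leq_trans (ltnW lt_b); rewrite leq_addl.
Qed.

Lemma diff_homotopy_near : exists C, forall b : tup n k.+1, vtup b ->
  int_comb (near d b 0 (k' := k.+1)) (C * (wt b).+1 ^ k.+1)
    (fun f : tupfun K n k.+1 => \sum_(l < n) (\sum_(s : 'S_k.+2 | s != 1%g) (-1) ^+ s * defect d l s f b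
       - (weight_power d l b)%:R * f b)).
Proof.
by apply: growth_sum => l _; exact: defect_growth.
Qed.

End CohomologyReduction.

Lemma eq_big_all (V : zmodType) (T : Type) (P : T -> bool) (s : seq T) (F G : T -> V) :
  all P s -> (forall p, P p -> F p = G p) -> \sum_(p <- s) F p = \sum_(p <- s) G p.
Proof.
move=> Ps FG; elim: s Ps => [|p s IHs] /=; first by rewrite !big_nil.
by case/andP=> Pp Ps; rewrite !big_cons FG ?IHs.
Qed.

Section FiniteTuples.
Variables (n W k : nat).

Fact mdeg0_lt : (mdeg (0%MM : 'X_{1..n}) < W.+2)%N.
Proof. by rewrite mdeg0. Qed.

(** In weight at most W, each entry has degree at most W + 1. *)
Definition btup := {ffun 'I_k -> 'X_{1..n < W.+2} * 'I_n}.
Definition of_btup (i : btup) : tup n k := fun q => (bmnm (i q).1, (i q).2).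
Definition to_btup (b : tup n k) : btup :=
  [ffun q => (insubd (BMultinom mdeg0_lt) (b q).1, (b q).2)].

Lemma to_btupK b : (wt b <= W)%N -> of_btup (to_btup b) = b.
Proof.
move=> leW; apply/funext => q; rewrite /of_btup ffunE [RHS]surjective_pairing.
congr pair; rewrite /= -[LHS]/(eqtype.val _) insubdK //.
by rewrite -topredE /= ltnS (leq_trans (mdeg_le_wt b q)) // ltnS.
Qed.

End FiniteTuples.

Section Reduction.
Variables (K : fieldType) (charK0 : [pchar K] =i pred0) (n d : nat).
Hypothesis n_ge1 : (0 < n)%N.
Local Notation L := (Ld K n d).
Local Notation cochain := (Defs.cochain L).
Local Notation vtup := (@vtup n d _).

(** [W0] comes from the growth constants alone and serves all cocycles; only the upper bound [W]
    depends on [c]. The primitive is the combination of the [homotopy (c_ t)] given by the orbit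
    lemma. *)
Lemma cocycle_small_weight k : exists W0, forall c : cochain k.+1,
  continuous_cochain c -> Ld_diff c = 0 ->
  exists2 u : cochain k, continuous_cochain u &
    forall b, vtup b -> (W0 < wt b)%N -> coefs c b = coefs (Ld_diff u) b.
Proof.
have [C nearC] := diff_homotopy_near charK0 n d k.
have [W0 diagC] := diagonal_large d k n_ge1 C.
exists W0 => c cc dc.
pose c_ t := iter t (fun z => Ld_diff (homotopy z)) c.
have cc_ t : continuous_cochain (c_ t).
  elim: t => [//|t IHt]; apply: continuous_diff => //; exact: homotopy_continuous.
have dc_ t : Ld_diff (c_ t) = 0.
  by case: t => [//|t]; apply: Ld_diffK => //; exact: homotopy_continuous.
pose row b (s : seq (int * tup n k.+1)) := vtup b ->
  [/\ all (fun p => near d b 0 p.2) s, (\sum_(p <- s) `|p.1|%N <= C * (wt b).+1 ^ k.+1)%N &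
    forall t, coefs (c_ t.+1) b = (diagonal d b)%:R * coefs (c_ t) b +
      \sum_(p <- s) p.1%:~R * coefs (c_ t) p.2].
have /choice[sl slP] : forall b, exists s, row b s.
  move=> b; have [vb|nvb] := boolP (vtup b); last by exists [::]; rewrite /row (negPf nvb).
  have [s [Ps sN sF]] := nearC b vb; exists s => _; split=> // t.
  rewrite -sF [LHS]coefs_diff_homotopy // sumrB /diagonal natr_sum mulr_suml.
  by rewrite addrC subrK.
have [W leW] : exists W, forall b t, vtup b -> (W < wt b)%N -> coefs (c_ t) b = 0.
  (* Above this weight some entry has degree greater than [m], where [c] vanishes; the iterates
     inherit this because each row preserves weight. *)
  have [_ _ [m dm c0]] := cc; exists (k.+1 * m)%N => b t; elim: t b => [|t IHt] b vb lt_b.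
    have [q lt_q] : exists q, (m < mdeg (b q).1)%N.
      apply: contrapT => /forallNP le_b; move: lt_b; rewrite ltnNge => /negP; apply.
      rewrite -[X in (_ <= X * _)%N](card_ord k.+1) -sum_nat_const; apply: leq_sum => q _.
      by apply: leq_trans (leq_pred _) _; rewrite leqNgt; apply/negP/le_b.
    by apply: (c0 _ q); exact: xmono_order.
  have [Ps _ ->] := slP b vb; rewrite IHt // mulr0 add0r.
  rewrite (eq_big_all Ps (G := fun=> 0)) ?big1 // => p /andP[vp /eqP wp].
  by rewrite IHt ?mulr0 //; lia.
pose inr (i : btup n W k.+1) := vtup (of_btup i) && (W0 < wt (of_btup i) <= W)%N.
(* Outside the range the system is completed by identity rows acting on zero entries, which are
   trivially dominant. *)
pose D i := if inr i then diagonal d (of_btup i) else 1%N.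
pose s i := if inr i then [seq (p.1, to_btup W p.2) | p <- sl (of_btup i)] else [::].
pose x t i := if inr i then coefs (c_ t) (of_btup i) else 0.
have [T [q xE]] : exists T, exists q : nat -> K, forall i, x 0%N i = \sum_(t < T) q t * x t.+1 i.
  apply: (@dominant_orbit _ charK0 _ D s) => [i|t i]; rewrite /D /s /x.
    case: ifP => [/andP[vi /andP[lt_i _]]|_]; last by rewrite big_nil.
    have [_ le_s _] := slP _ vi.
    by rewrite big_map; apply: leq_ltn_trans le_s _; exact: diagC.
  case: ifP => [/andP[vi /andP[lt_i le_i]]|_]; last by rewrite mulr0 big_nil addr0.
  have [Ps _ ->] := slP _ vi; rewrite big_map; congr (_ + _).
  apply: (eq_big_all Ps) => p /andP[vp /eqP wp] /=.
  have wpE : wt p.2 = wt (of_btup i) by lia.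
  by rewrite /inr to_btupK ?wpE // vp lt_i le_i.
exists (\sum_(t < T) q t *: homotopy (c_ t)) => [|b vb lt_b].
  by apply: sum_continuous => t _; apply: scale_continuous; exact: homotopy_continuous.
rewrite Ld_diff_sum /coefs cochain_sumE.
have -> : \sum_(t < T) Ld_diff (q t *: homotopy (c_ t)) (xmono K d \o b) =
          \sum_(t < T) q t * coefs (c_ t.+1) b.
  by apply: eq_bigr => t _; rewrite Ld_diffZ.
rewrite -/(coefs c b); have [le_b|gt_b] := leqP (wt b) W.
  have := xE (to_btup W b); rewrite /x /inr to_btupK // vb lt_b le_b /= => ->.
  by [].
rewrite (leW b 0%N) // big1 // => t _.
by rewrite leW ?mulr0.
Qed.

End Reduction.

(** * Cocycles of bounded weight and finite dimension *)

Section Finiteness.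
Variables (K : fieldType) (charK0 : [pchar K] =i pred0) (n d k : nat).
Hypothesis n_ge1 : (0 < n)%N.
Local Notation vtup := (@vtup n d _).
Local Notation cocycle := (cocycle K n d k).

Lemma cocycleP (z : cocycle) : continuous_cochain (cocycle_val z) /\ Ld_diff (cocycle_val z) = 0.
Proof. by have /asboolP := cocycle_valP z. Qed.

Lemma cocycle_representative : exists W0, forall z : cocycle, exists2 z' : cocycle,
  (forall b, vtup b -> (W0 < wt b)%N -> coefs (cocycle_val z') b = 0) &
  z - z' \in @is_coboundary K n d k.
Proof.
case: k => [|k'].
  (* In degree 0 the only tuple is empty, of weight 0. *)
  exists 0%N => z; exists z; first by move=> b _; rewrite /wt big_ord0.
  by rewrite subrr rpred0.
have [W0 red] := cocycle_small_weight charK0 d n_ge1 k'; exists W0 => z.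
have [cz dz] : continuous_cochain (cocycle_val z) /\ Ld_diff (cocycle_val z) = 0.
  by have /asboolP := cocycle_valP z.
have [u cu uE] := red _ cz dz.
have uP : Ld_diff u \in @is_cocycle K n d k'.+1.
  by apply/asboolP; split; [exact: continuous_diff | exact: Ld_diffK].
exists (z - MkCocycle uP) => [b vb lt_b|].
  rewrite /coefs -[LHS]/(coefs (cocycle_val z) b - coefs (Ld_diff u) b).
  by rewrite uE // subrr.
rewrite opprB addrC subrK; apply/asboolP; exists u => //.
Qed.

Lemma finite_dimensional_Hc : finite_dimensional (Hc K n d k).
Proof.
have [W0 rep] := cocycle_representative.
pose S (z : cocycle) := forall b, vtup b -> (W0 < wt b)%N -> coefs (cocycle_val z) b = 0.
pose ev (i : 'I_#|btup n W0 k|) (z : cocycle) : K := coefs (cocycle_val z) (of_btup (enum_val i)).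
have valZD (a : K) (y z : cocycle) b :
  coefs (cocycle_val (a *: y + z)) b = a * coefs (cocycle_val y) b + coefs (cocycle_val z) b.
  by [].
pose p (z : cocycle) : Hc K n d k := (\pi_(lmod_quot (@is_coboundary K n d k)) z)%qT.
apply: (@finite_dimensional_quot _ _ _ p S _ ev).
- move=> a y z; have pZ : p (a *: y) = a *: p y by rewrite /p -pi_scale.
  rewrite -pZ; exact: (Quotient.pi_add (submod_mem (@is_coboundary K n d k))).
- move=> v; have [z' Sz' zz'] := rep (generic_quotient.repr v); exists z' => //.
  rewrite /p -[RHS]generic_quotient.reprK; apply/eqP; rewrite -Quotient.idealrBE.
  by rewrite -opprB rpredN.
- by move=> a y z Sy Sz b vb lt_b; rewrite valZD Sy // Sz // mulr0 addr0.
- by move=> b _ _.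
- by move=> i a y z; rewrite /ev valZD.
move=> z Sz evz; have [cz _] := cocycleP z; apply: val_inj.
apply: coefs_eq0 => // b vb.
have [le_b|lt_b] := leqP (wt b) W0; last exact: Sz.
by rewrite -(to_btupK le_b) -[to_btup W0 b]enum_rankK; exact: evz.
Qed.

End Finiteness.

Theorem corollary3p2p3 (K : fieldType) (charK0 : [pchar K] =i pred0)
    (k n d : nat) (n_ge1 : (1 <= n)%N) :
  finite_dimensional (Hc K n d k).
Proof. exact: finite_dimensional_Hc. Qed.
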